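(* Let $\mu$ be a probability measure on $\mathbf R^d$ and $p\in[1,2]$. The following are equivalent: (1) There exist $a,b\ge0$ such that for every $n\ge1$ and every measurable $A\subset(\mathbf R^d)^n$ with $\mu^n(A)\ge1/2$, \[\forall r\ge0,\qquad \mu^n\big(A+\sqrt r\,B_2+r^{1/p}B_p\big)\ge1-b\,e^{-ar}.\] (2) There is $C>0$ with $\mathcal T_{2,p}(\nu,\mu)\le C\,H(\nu\,|\,\mu)$ for all probability measures $\nu$ on $\mathbf R^d$. More precisely, if (1) holds with constants $a,b$ then (2) holds with $C=288/a$; conversely, if (2) holds with constant $C$ then (1) holds with $b=2$ and $a=1/(2C)$.
   Context: $B_2$ and $B_p$ are the unit balls of $(\mathbf R^d)^n\cong\mathbf R^{dn}$ for the $\ell^2$ and $\ell^p$ norms respectively. $\alpha_p(u)=\min(|u|^2,|u|^p)$. For probability measures $\nu_1,\nu_2$ on $(\mathbf R^d)^n$, $\mathcal T_{2,p}(\nu_1,\nu_2)=\inf_\pi\int\sum_{i=1}^n\sum_{j=1}^d\alpha_p(x^i_j-y^i_j)\,d\pi(x,y)$, the infimum over couplings of $\nu_1,\nu_2$, where $x=(x^1,\dots,x^n)$, $x^i=(x^i_1,\dots,x^i_d)\in\mathbf R^d$ (in (2), $n=1$). $H(\nu\,|\,\mu)=\int\log\frac{d\nu}{d\mu}d\nu$ if $\nu\ll\mu$, else $+\infty$.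
   Formalization: In (1) the constant a is required to be positive (a>0, b≥0) instead of a≥0: with a=0, b=1 condition (1) holds for every μ, while (2) fails for heavy-tailed μ such as the Cauchy law, and C=288/a is undefined. *)

(* Defs.v *)
From HB Require Import structures.
From mathcomp Require Import all_boot all_order all_algebra.
From mathcomp Require Import all_classical all_reals all_analysis.
Set Implicit Arguments. Unset Strict Implicit. Unset Printing Implicit Defensive.
Import Order.TTheory GRing.Theory Num.Theory.
Import numFieldNormedType.Exports.
Local Open Scope classical_set_scope.
Local Open Scope ring_scope.

(* Points of R^d are d-tuples of reals; points of (R^d)^n are n-tuples of
   d-tuples.  Both carry the product (= Borel) sigma-algebra of the library. *)

Definition alpha {R : realType} (p u : R) : R := Num.min (u ^+ 2) (`|u| `^ p).

Definition coord {R : realType} (d n : nat) (x : n.-tuple (d.-tuple R))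
  (i : 'I_n) (j : 'I_d) : R := tnth (tnth x i) j.

Definition l2norm {R : realType} (d n : nat) (u : n.-tuple (d.-tuple R)) : R :=
  Num.sqrt (\sum_(i < n) \sum_(j < d) coord u i j ^+ 2).
Definition lpnorm {R : realType} (d n : nat) (p : R) (u : n.-tuple (d.-tuple R)) : R :=
  (\sum_(i < n) \sum_(j < d) `|coord u i j| `^ p) `^ p^-1.

Definition enlarge {R : realType} (d n : nat) (p r : R)
  (A : set (n.-tuple (d.-tuple R))) : set (n.-tuple (d.-tuple R)) :=
  [set x | exists a u v, [/\ A a, l2norm u <= 1, lpnorm p v <= 1 &
     forall i j, coord x i j = coord a i j + Num.sqrt r * coord u i j
                                + r `^ p^-1 * coord v i j]].

(* outer measure (the enlarged set need not be Borel) *)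
Definition outer {R : realType} dT (T : measurableType dT)
  (P : set T -> \bar R) (S : set T) : \bar R :=
  ereal_inf [set P B | B in [set B | measurable B /\ S `<=` B]].

Definition is_product {R : realType} (d n : nat)
  (mu : probability (d.-tuple R) R) (P : probability (n.-tuple (d.-tuple R)) R) :=
  forall A : 'I_n -> set (d.-tuple R), (forall i, measurable (A i)) ->
    P [set x | forall i, A i (tnth x i)] = (\prod_(i < n) mu (A i))%E.

Definition coupling {R : realType} (d : nat) (nu1 nu2 : probability (d.-tuple R) R)
  (pi : probability (d.-tuple R * d.-tuple R)%type R) :=
  (forall A, measurable A -> pi (A `*` setT) = nu1 A) /\
  (forall B, measurable B -> pi (setT `*` B) = nu2 B).

Definition Tcost {R : realType} (d : nat) (p : R) (nu1 nu2 : probability (d.-tuple R) R)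
  : \bar R :=
  ereal_inf [set (\int[pi]_z (\sum_(j < d) alpha p (tnth z.1 j - tnth z.2 j))%:E)%E
            | pi in [set pi | coupling nu1 nu2 pi]].

Definition entropy {R : realType} (d : nat) (nu mu : probability (d.-tuple R) R)
  : \bar R :=
  if `[< nu `<< mu >] then
    (\int[nu]_x (ln (fine (Radon_Nikodym (charge_of_finite_measure nu) mu x)))%:E)%E
  else +oo%E.

Definition concentration {R : realType} (d : nat) (mu : probability (d.-tuple R) R)
  (p a b : R) :=
  forall n : nat, (0 < n)%N ->
  forall P : probability (n.-tuple (d.-tuple R)) R, is_product mu P ->
  forall A : set (n.-tuple (d.-tuple R)), measurable A -> ((1/2)%:E <= P A)%E ->
  forall r : R, 0 <= r ->
    ((1 - b * expR (- (a * r)))%:E <= outer P (enlarge p r A))%E.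

Definition transport_entropy {R : realType} (d : nat) (mu : probability (d.-tuple R) R)
  (p C : R) :=
  forall nu : probability (d.-tuple R) R, (Tcost p nu mu <= C%:E * entropy nu mu)%E.

(* Main.v *)
(** (2) => (1).  Duality turns the transport inequality into
    [int e^(F/C) dmu <= exp (int G dmu / C)] whenever [F x - G y <= cost x y]
    (test it on [nu = e^(F/C) mu / Z]).  This form tensorizes by Fubini: for
    fixed second variables, [C ln int e^(F/C) dmu] and [int G dmu] are again
    admissible.  With [F = r 1_(~B)] and [G = r 1_(~A)], where [B] contains the
    enlargement of [A], it gives concentration.

    (1) => (2).  Quantize R^d into finitely many cells.  If
    [mu^n (enlarge r A) >= 1 - b e^(-ar)] for [A] the set of samples typical for
    [mu], then for [r] slightly above [n H(nu|mu) / a] this enlargement meets the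
    set of samples typical for [nu], whose [mu^n]-mass is about
    [e^(-n H(nu|mu))].  This yields samples [x] (typical for [nu]) and [y]
    (typical for [mu]) with [sum_i cost (x_i, y_i) <= 8 r].  The empirical
    coupling of [x] and [y] is spread over the cells to an almost complete
    coupling of [nu] and [mu]; the small missing mass is coupled independently,
    at a small cost by uniform integrability.  The resulting constant is
    [32 / a]. *)

Require Import Defs.
From HB Require Import structures.
From mathcomp Require Import all_boot all_order all_algebra.
From mathcomp Require Import all_classical all_reals all_analysis.
From mathcomp Require Import measurable_realfun ring lra.
Import Order.TTheory GRing.Theory Num.Theory.
Import numFieldNormedType.Exports.
Local Open Scope classical_set_scope.
Local Open Scope ring_scope.

(** * The cost function and the enlargement *)

(** For [p < 2] the cost [alpha p] is not convex; a quasi-triangle inequality with factor 4 takes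
    the place of the triangle inequality, and the constants 8 and 32 come from it. Cost at most [r]
    puts a point into the enlargement of parameter [r], whereas the enlargement only gives cost at
    most [8 * r]: 4 times the two contributions [r] of the Euclidean and of the [p]-part. Moving
    samples inside their cells costs one more factor 4, whence 32.

    Two points shape the coupling built for (1) => (2). The empirical frequencies must stay below
    [1 + eta] times the cell masses, so that division by [1 + eta] leaves a measure below both
    marginals; an additive error would not fit into cells of small mass. And the cost is unbounded,
    so the missing mass is cheap only if the cost from the origin is integrable under [nu] too:
    concentration for [n = 1] gives an exponential moment under [mu], which finite entropy carries
    over to [nu]. *)

Section Alpha.
Context {R : realType} (p : R).
Hypothesis p12 : 1 <= p <= 2.

Let p1 : 1 <= p. Proof. by case/andP: p12. Qed.
Let p2 : p <= 2. Proof. by case/andP: p12. Qed.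

Lemma alpha_ge0 (u : R) : 0 <= alpha p u.
Proof. by rewrite /alpha le_min sqr_ge0 powR_ge0. Qed.

Lemma alpha_le_sqr (u : R) : alpha p u <= u ^+ 2.
Proof. by rewrite /alpha ge_min lexx. Qed.

Lemma alpha_le_pow (u : R) : alpha p u <= `|u| `^ p.
Proof. by rewrite /alpha ge_min lexx orbT. Qed.

Lemma alpha_le_norm (u v : R) : `|u| <= `|v| -> alpha p u <= alpha p v.
Proof.
move=> uv; have p0 : 0 <= p by have := p1; lra.
rewrite /alpha le_min !ge_min -(real_normK (num_real u)) -(real_normK (num_real v)).
by rewrite lerXn2r ?nnegrE//= ge0_ler_powR ?nnegrE// orbT.
Qed.

Lemma alpha_normr (u : R) : alpha p `|u| = alpha p u.
Proof. by rewrite /alpha normr_id real_normK// num_real. Qed.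

Lemma alphaN (u : R) : alpha p (- u) = alpha p u.
Proof. by rewrite -alpha_normr normrN alpha_normr. Qed.

(** Doubling multiplies the quadratic branch by 4 and the other one by $2^p$, at most 4 because
    [p <= 2]. *)
Lemma alpha_double (u : R) : alpha p (2 * u) <= 4 * alpha p u.
Proof.
rewrite /alpha minr_pMr; last by [].
rewrite le_min !ge_min; apply/andP; split; apply/orP; [left|right].
  by rewrite exprMn; lra.
rewrite normrM powRM// ler_wpM2r ?powR_ge0// ger0_norm; last by lra.
have -> : 4 = 2 `^ (2%:R : R) :> R by rewrite powR_mulrn; lra.
by rewrite ler_powR//; have := p2; lra.
Qed.

(** From $|s+t|\le 2\max(|s|,|t|)$, monotonicity in the absolute value, and doubling. *)
Lemma alphaD_max (s t : R) : alpha p (s + t) <= 4 * alpha p (Num.max `|s| `|t|).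
Proof.
apply: le_trans (alpha_double _); apply: alpha_le_norm.
rewrite (le_trans (ler_normD _ _))// normrM ger0_norm; last by lra.
rewrite ger0_norm ?le_max ?normr_ge0//.
have : `|s| <= Num.max `|s| `|t| by rewrite le_max lexx.
have : `|t| <= Num.max `|s| `|t| by rewrite le_max lexx orbT.
lra.
Qed.

Lemma alphaD (s t : R) : alpha p (s + t) <= 4 * (alpha p s + alpha p t).
Proof.
rewrite (le_trans (alphaD_max _ _))// ler_wpM2l//.
have [s0 t0] := (alpha_ge0 s, alpha_ge0 t).
by rewrite /Num.max; case: ifP => _; rewrite alpha_normr; lra.
Qed.

Lemma alphaD_sqr_pow (s t : R) : alpha p (s + t) <= 4 * (s ^+ 2 + `|t| `^ p).
Proof.
rewrite (le_trans (alphaD _ _))// ler_wpM2l//.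
by apply: lerD; [exact: alpha_le_sqr | exact: alpha_le_pow].
Qed.

Lemma measurable_alpha : measurable_fun setT (alpha p).
Proof.
apply: measurable_minr; first exact: exprn_measurable.
by apply: (@measurableT_comp _ _ _ _ _ _ (fun y : R => y `^ p)).
Qed.

(** For [p <= 2] the two branches cross at $|u|=1$. With [pow_le_alpha] this tells which branch is
    the minimum on each side. *)
Lemma sqr_le_alpha (u : R) : `|u| <= 1 -> u ^+ 2 <= alpha p u.
Proof.
move=> u1; rewrite /alpha le_min lexx/=.
have [->|u0] := eqVneq u 0; first by rewrite expr0n powR_ge0.
rewrite -(real_normK (num_real u)) -powR_mulrn// ger_powR ?normr_gt0 ?u0//; have := p2; lra.
Qed.

Lemma pow_le_alpha (u : R) : 1 <= `|u| -> `|u| `^ p <= alpha p u.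
Proof.
move=> u1; rewrite /alpha le_min lexx andbT.
by rewrite -(real_normK (num_real u)) -powR_mulrn// ler_powR//; have := p2; lra.
Qed.

End Alpha.

Section Enlarge.
Context {R : realType} {d n : nat} (p : R).
Hypothesis p12 : 1 <= p <= 2.

Let p1 : 1 <= p. Proof. by case/andP: p12. Qed.

Implicit Types x y : n.-tuple (d.-tuple R).

Definition ncost x y : R :=
  \sum_(i < n) \sum_(j < d) alpha p (Defs.coord x i j - Defs.coord y i j).

(** The radii $\sqrt r$ and $r^{1/p}$ are those for which the squares of the first displacement and
    the $p$-th powers of the second each sum to at most [r]; [alphaD_sqr_pow] then gives
    $4(r+r)$. *)
Lemma enlarge_ncost r A x : 0 <= r -> enlarge p r A x ->
  exists2 y, A y & ncost x y <= 8 * r.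
Proof.
move=> r0 [y [u [v [Ay u1 v1 xE]]]]; exists y => //.
have p0 : 0 < p by have := p1; lra.
have u2 : \sum_(i < n) \sum_(j < d) (Num.sqrt r * Defs.coord u i j) ^+ 2 <= r.
  under eq_bigr do under eq_bigr do rewrite exprMn sqr_sqrtr//.
  under eq_bigr do rewrite -mulr_sumr.
  rewrite -mulr_sumr -[leRHS]mulr1 ler_wpM2l//.
  by move: u1; rewrite /l2norm -{1}sqrtr1 ler_sqrt// sumr_ge0// => i _;
     rewrite sumr_ge0// => j _; exact: sqr_ge0.
have v2 : \sum_(i < n) \sum_(j < d) `|r `^ p^-1 * Defs.coord v i j| `^ p <= r.
  have E z : `|r `^ p^-1 * z| `^ p = r * `|z| `^ p.
    by rewrite normrM powRM// ger0_norm ?powR_ge0// -powRrM mulVf ?powRr1//; lra.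
  under eq_bigr do under eq_bigr do rewrite E.
  under eq_bigr do rewrite -mulr_sumr.
  rewrite -mulr_sumr -[leRHS]mulr1 ler_wpM2l//.
  set S := (X in X <= 1); rewrite leNgt; apply/negP => S1.
  move: v1; rewrite /lpnorm -/S leNgt => /negP; apply.
  have <- : 1 `^ p^-1 = 1 :> R by rewrite powR1.
  by rewrite gt0_ltr_powR ?nnegrE ?invr_gt0//; lra.
apply: (@le_trans _ _ (4 * (r + r))); last by lra.
set S := (X in X <= r) in u2; set S' := (X in X <= r) in v2.
apply: (@le_trans _ _ (4 * (S + S'))); last by rewrite ler_wpM2l//; exact: lerD.
rewrite /S /S' -big_split/= mulr_sumr; apply: ler_sum => i _.
rewrite -big_split/= mulr_sumr; apply: ler_sum => j _.
by rewrite xE (_ : _ - _ = Num.sqrt r * Defs.coord u i j + r `^ p^-1 * Defs.coord v i j);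
   [exact: alphaD_sqr_pow | ring].
Qed.

(** Each coordinate of the displacement goes entirely to one part: to the Euclidean one if it is at
    most 1 in absolute value, to the $\ell^p$ one otherwise. There [alpha p] is the matching power,
    so the total cost pays for both parts and no constant is lost. *)
Lemma ncost_enlarge r A x y : A y -> ncost x y <= r -> enlarge p r A x.
Proof.
move=> Ay xyr; have p0 : 0 < p by have := p1; lra.
pose z i j := Defs.coord x i j - Defs.coord y i j.
have r0 : 0 <= r.
  by apply: le_trans xyr; do 2 (apply: sumr_ge0 => ? _); exact: alpha_ge0.
pose u := [tuple [tuple if `|z i j| <= 1 then z i j / Num.sqrt r else 0 | j < d] | i < n].
pose v := [tuple [tuple if `|z i j| <= 1 then 0 else z i j / r `^ p^-1 | j < d] | i < n].
have uE i j : Defs.coord u i j = if `|z i j| <= 1 then z i j / Num.sqrt r else 0.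
  by rewrite /Defs.coord !tnth_mktuple.
have vE i j : Defs.coord v i j = if `|z i j| <= 1 then 0 else z i j / r `^ p^-1.
  by rewrite /Defs.coord !tnth_mktuple.
(* [u] and [v] divide by powers of [r]. For [r = 0], zero cost forces [x] and [y] to agree, and zero
   displacements serve. *)
have [r1|r1] := ltP 0 r; last first.
  have r00 : r = 0 by lra.
  have z0 i j : z i j = 0.
    have S0 : ncost x y = 0.
      apply/eqP; rewrite eq_le -{1}r00 xyr/=.
      by do 2 (apply: sumr_ge0 => ? _); exact: alpha_ge0.
    have /psumr_eq0P : \sum_(i < n) \sum_(j < d) alpha p (z i j) = 0 by [].
    have sge0 k : true -> 0 <= \sum_(j < d) alpha p (z k j).
      by move=> _; apply: sumr_ge0 => ? _; exact: alpha_ge0.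
    move=> /(_ sge0 i isT)/psumr_eq0P.
    move=> /(_ (fun k _ => alpha_ge0 p (z i k)) j isT) a0.
    have [z1|z1] := leP `|z i j| 1.
      have := sqr_le_alpha p p12 _ z1; rewrite a0 => z2.
      by apply/eqP; rewrite -sqrf_eq0 eq_le z2 sqr_ge0.
    have := pow_le_alpha p p12 _ (ltW z1); rewrite a0.
    rewrite leNgt powR_gt0//; lra.
  pose w : n.-tuple (d.-tuple R) := [tuple [tuple 0 | j < d] | i < n].
  have wE i j : Defs.coord w i j = 0 by rewrite /Defs.coord !tnth_mktuple.
  exists y, w, w; split => //.
  - rewrite /l2norm; under eq_bigr do under eq_bigr do rewrite wE expr0n.
    by rewrite big1 ?sqrtr0// => i _; rewrite big1.
  - rewrite /lpnorm; under eq_bigr do under eq_bigr do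
      rewrite wE normr0 powR0 ?gt_eqF//.
    rewrite big1 ?powR0 ?invr_eq0 ?gt_eqF// => i _; by rewrite big1.
  - by move=> i j; rewrite wE !mulr0 !addr0; have := z0 i j; rewrite /z; lra.
exists y, u, v; split => //.
- rewrite /l2norm -[leRHS]sqrtr1 ler_sqrt ?ler01//.
  apply: (@le_trans _ _ (r^-1 * ncost x y)); last by rewrite mulrC ler_pdivrMr ?mul1r.
  rewrite mulr_sumr; apply: ler_sum => i _.
  rewrite mulr_sumr; apply: ler_sum => j _.
  rewrite uE; case: ifPn => z1.
    by rewrite exprMn exprVn sqr_sqrtr// mulrC ler_wpM2l ?invr_ge0//; exact: sqr_le_alpha.
  by rewrite expr0n/= mulr_ge0 ?invr_ge0 ?alpha_ge0.
- have -> : 1 = 1 `^ p^-1 :> R by rewrite powR1.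
  rewrite /lpnorm ge0_ler_powR ?nnegrE ?invr_ge0//; first lra.
    by do 2 (apply: sumr_ge0 => ? _); exact: powR_ge0.
  apply: (@le_trans _ _ (r^-1 * ncost x y)); last by rewrite mulrC ler_pdivrMr ?mul1r.
  rewrite mulr_sumr; apply: ler_sum => i _.
  rewrite mulr_sumr; apply: ler_sum => j _.
  rewrite vE; case: ifPn => z1.
    by rewrite normr0 powR0 ?gt_eqF// mulr_ge0 ?invr_ge0 ?alpha_ge0.
  rewrite -ltNge in z1.
  rewrite normrM normfV powRM ?invr_ge0// (ger0_norm (powR_ge0 _ _)).
  rewrite -(powR_inv1 (powR_ge0 r p^-1)) -!powRrM mulrC.
  rewrite (_ : p^-1 * (-1 * p) = -1); last by field; rewrite gt_eqF.
  by rewrite powR_inv1// ler_wpM2l ?invr_ge0//; exact: (pow_le_alpha p p12 _ (ltW z1)).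
- move=> i j; rewrite uE vE; have := sqrtr_gt0 r; rewrite r1 => sr.
  have pr : 0 < r `^ p^-1 by exact: powR_gt0.
  case: ifPn => _; rewrite mulr0 addr0; rewrite ?(mulrC (z i j)) mulVKf ?gt_eqF//.
    by rewrite /z; ring.
  by rewrite /z; ring.
Qed.

End Enlarge.

(** * Typical sequences in finite product spaces *)

(** $e^x\le 1/(1-x)$, and $(1+x+2x^2)(1-x)=1+x^2(1-2x)\ge 1$ for $x\le 1/2$. *)
Lemma expR_le_quadratic {R : realType} (x : R) :
  `|x| <= 2^-1 -> expR x <= 1 + x + 2 * x ^+ 2.
Proof.
rewrite ler_norml => /andP[x1 x2].
have e1 : 0 < 1 - x by lra.
have : expR x <= (1 - x)^-1.
  rewrite -[x]opprK expRN opprK lef_pV2 ?posrE ?expR_gt0//.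
  exact: (expR_ge1Dx (- x)).
move/le_trans; apply; rewrite -[leLHS]mul1r ler_pdivrMr//.
nra.
Qed.

Section FiniteProduct.
Context {R : realType} {K : finType} (w : K -> R).
Hypotheses (w0 : forall k, 0 <= w k) (w1 : \sum_k w k = 1).

Definition wprod n (s : {ffun 'I_n -> K}) : R := \prod_i w (s i).

Lemma wprod_ge0 n (s : {ffun 'I_n -> K}) : 0 <= wprod n s.
Proof. by apply: prodr_ge0. Qed.

Lemma sum_wprod n : \sum_s wprod n s = 1.
Proof.
rewrite /wprod -(bigA_distr_bigA (fun (i : 'I_n) k => w k)).
by rewrite big1.
Qed.

Lemma sum_wprod_exp n (g : K -> R) :
  \sum_s wprod n s * expR (\sum_(i < n) g (s i)) = (\sum_k w k * expR (g k)) ^+ n.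
Proof.
transitivity (\prod_(i < n) \sum_k w k * expR (g k)); last first.
  by rewrite prodr_const card_ord.
rewrite (bigA_distr_bigA (fun (i : 'I_n) k => w k * expR (g k))).
by apply: eq_bigr => s _; rewrite expR_sum -big_split.
Qed.

(** Exponential Markov inequality for [h], whose mean is [- eta]. The witness [rho] is its moment
    generating function at a small [l], at most $1-l\eta+2(lL)^2<1$ and independent of [n]. *)
Lemma chernoff (g : K -> R) (eta : R) : 0 < eta ->
  exists2 rho : R, 0 <= rho < 1 & forall n,
    \sum_(s : {ffun 'I_n -> K} | \sum_(i < n) g (s i) > n%:R * (\sum_k w k * g k + eta)) wprod n s
      <= rho ^+ n.
Proof.
move=> eta0; set m := \sum_k _; pose h k := g k - m - eta.
have hm : \sum_k w k * h k = - eta.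
  under eq_bigr do rewrite /h -addrA mulrDr.
  by rewrite big_split/= -mulr_suml w1 mul1r -/m; ring.
pose L := 1 + \sum_k `|h k|.
have L1 : 1 <= L by rewrite lerDl sumr_ge0.
have hL k : `|h k| <= L.
  rewrite /L (bigD1 k)//= addrCA lerDl addr_ge0// sumr_ge0//.
(* The two summands of the denominator yield $4lL^2\le\eta$ and $lL\le 1/2$ respectively. *)
pose l := eta / (4 * L ^+ 2 + 2 * L * eta).
have D0 : 0 < 4 * L ^+ 2 + 2 * L * eta by nra.
have l0 : 0 < l by rewrite divr_gt0.
have lL : l * L <= 2^-1.
  rewrite /l mulrAC ler_pdivrMr//; nra.
have lL2 : 4 * (l * L ^+ 2) <= eta.
  rewrite /l mulrAC mulrA ler_pdivrMr//; nra.
exists (\sum_k w k * expR (l * h k)).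
  apply/andP; split; first by apply: sumr_ge0 => k _; rewrite mulr_ge0 ?expR_ge0.
  apply: (@le_lt_trans _ _ (\sum_k w k * (1 + l * h k + 2 * (l * L) ^+ 2))).
    apply: ler_sum => k _; rewrite ler_wpM2l//.
    have lh : `|l * h k| <= l * L by rewrite normrM gtr0_norm// ler_wpM2l// ltW.
    apply: le_trans (expR_le_quadratic _ _) _; first exact: le_trans lh lL.
    rewrite lerD2l ler_wpM2l// -(real_normK (num_real (l * h k))).
    by rewrite lerXn2r ?nnegrE// mulr_ge0//; lra.
  have -> : \sum_k w k * (1 + l * h k + 2 * (l * L) ^+ 2) =
      1 - l * eta + 2 * (l * L) ^+ 2.
    have E k : w k * (1 + l * h k + 2 * (l * L) ^+ 2) =
      w k + l * (w k * h k) + w k * (2 * (l * L) ^+ 2) by ring.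
    under eq_bigr do rewrite E.
    rewrite !big_split/= -mulr_sumr -mulr_suml w1 hm; ring.
  nra.
move=> n; rewrite -sum_wprod_exp.
apply: (@le_trans _ _ (\sum_(s : {ffun 'I_n -> K} | \sum_(i < n) g (s i) > n%:R * (m + eta))
    wprod n s * expR (\sum_i l * h (s i)))).
  (* On the deviation event the exponent is nonnegative, so the exponential factor is at least 1. *)
  apply: ler_sum => s sn; rewrite ler_peMr ?wprod_ge0//.
  rewrite -expR0 ler_expR -mulr_sumr mulr_ge0//; first exact: ltW.
  rewrite /h; under eq_bigr do rewrite -addrA.
  rewrite big_split/= sumr_const card_ord -mulr_natl; lra.
rewrite [leRHS](bigID (fun s : {ffun 'I_n -> K} => \sum_(i < n) g (s i) > n%:R * (m + eta)))/=.
by rewrite lerDl sumr_ge0// => s _; rewrite mulr_ge0 ?wprod_ge0 ?expR_ge0.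
Qed.

(** One-sided on purpose: upper bounds on frequencies keep the empirical coupling below its
    marginals, and an upper bound on the log-likelihood ratio bounds [mu]-masses from below. *)
Definition typical {L : finType} (g : L -> K -> R) (eta : R) n :=
  [pred s : {ffun 'I_n -> K} |
    [forall l, \sum_(i < n) g l (s i) <= n%:R * (\sum_k w k * g l k + eta)]].

Lemma typical_half {L : finType} (g : L -> K -> R) (eta : R) : 0 < eta ->
  \forall n \near \oo, 2^-1 <= \sum_(s in typical g eta n) wprod n s.
Proof.
move=> eta0.
have rhoP l : {rho : R | 0 <= rho < 1 & forall n,
    \sum_(s : {ffun 'I_n -> K} | \sum_(i < n) g l (s i) > n%:R * (\sum_k w k * g l k + eta)) wprod n s
      <= rho ^+ n}.
  by apply: cid2; exact: chernoff.
pose rho l := s2val (rhoP l).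
have rho01 l : 0 <= rho l < 1 by exact: (s2valP (rhoP l)).
have rhoE l n : _ := s2valP' (rhoP l) n.
(* Share of each [l] in a union bound; the successor keeps [e] positive when [L] is empty. *)
pose e : R := (2 * #|L|.+1%:R)^-1.
have e0 : 0 < e by rewrite invr_gt0 mulr_gt0.
have : \forall n \near \oo, forall l, rho l ^+ n <= e.
  apply: filter_forall => l.
  have rl : `|rho l| < 1 by rewrite ger0_norm; case/andP: (rho01 l).
  have /cvgrPdist_le/(_ e e0) := cvg_expr rl.
  apply: filterS => n; rewrite sub0r normrN; apply: le_trans; exact: ler_norm.
apply: filterS => n rne.
have rn : \sum_l rho l ^+ n <= 2^-1.
  apply: (@le_trans _ _ (\sum_(l : L) e)); first by apply: ler_sum.
  rewrite sumr_const -[_ *+ _]mulr_natr /e invfM -mulrA ger_pMr ?invr_gt0//.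
  by rewrite mulrC ler_pdivrMr// mul1r ler_nat.
have := sum_wprod n; rewrite (bigID (mem (typical g eta n)))/= => S1.
suff : \sum_(s | s \notin typical g eta n) wprod n s <= \sum_l rho l ^+ n.
  by move: S1; lra.
apply: (@le_trans _ _ (\sum_l \sum_(s : {ffun 'I_n -> K} | \sum_(i < n) g l (s i) >
    n%:R * (\sum_k w k * g l k + eta)) wprod n s)); last first.
  by apply: ler_sum => l _; exact: rhoE.
under [leRHS]eq_bigr do rewrite big_mkcond/=.
rewrite exchange_big/= big_mkcond; apply: ler_sum => s _.
have nn l : 0 <= if \sum_(i < n) g l (s i) > n%:R * (\sum_k w k * g l k + eta)
  then wprod n s else 0 by case: ifP => // _; exact: wprod_ge0.
case: ifPn => [|_]; last exact: sumr_ge0.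
rewrite inE negb_forall => /existsP[l]; rewrite -ltNge => ln.
by rewrite (bigD1 l)//= ln lerDl sumr_ge0.
Qed.

End FiniteProduct.

(* The missing mass on both sides is transported independently. *)
Lemma coupling_completion {R : realType} {K : finType} (p q : K -> R) (w : K -> K -> R) :
  (forall k, 0 <= p k) -> (forall k, 0 <= q k) -> \sum_k p k = 1 -> \sum_k q k = 1 ->
  (forall k l, 0 <= w k l) ->
  (forall k, \sum_l w k l <= p k) -> (forall l, \sum_k w k l <= q l) ->
  exists Z h1 h2 : _, let m := 1 - \sum_k \sum_l w k l in
   [/\ forall k l, 0 <= h1 k /\ 0 <= h2 l,
     [/\ forall k, \sum_l Z k l = p k, forall l, \sum_k Z k l = q l &
      forall k l, 0 <= Z k l],
     forall k, h1 k <= p k,  forall l, h2 l <= q l &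
     [/\ \sum_k h1 k = m, \sum_l h2 l = m &
     forall k l, Z k l = w k l + h1 k * h2 l / m]].
Proof.
move=> p0 q0 p1 q1 w0 wp wq.
pose m := 1 - \sum_k \sum_l w k l.
pose h1 k := p k - \sum_l w k l; pose h2 l := q l - \sum_k w k l.
have h10 k : 0 <= h1 k by rewrite subr_ge0.
have h20 k : 0 <= h2 k by rewrite subr_ge0.
have h1m : \sum_k h1 k = m by rewrite sumrB p1.
have h2m : \sum_k h2 k = m by rewrite sumrB q1 exchange_big.
have m0 : 0 <= m by rewrite -h1m sumr_ge0.
(* If [m = 0], both defects vanish and [w] itself has the right marginals; the correction term has
   numerator 0. *)
have [mz|mn] := eqVneq m 0.
  have h1z k : h1 k = 0.
    by move: h1m; rewrite mz => /psumr_eq0P; apply.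
  have h2z k : h2 k = 0.
    by move: h2m; rewrite mz => /psumr_eq0P; apply.
  exists w, h1, h2; split => //.
  - split => //.
    + by move=> k; have := h1z k; rewrite /h1; lra.
    + by move=> k; have := h2z k; rewrite /h2; lra.
  - by move=> k; rewrite /h1 lerBlDr lerDl sumr_ge0.
  - by move=> k; rewrite /h2 lerBlDr lerDl sumr_ge0.
  - by split => // k l; rewrite h1z !mul0r addr0.
exists (fun k l => w k l + h1 k * h2 l / m), h1, h2; split => //.
- split.
  + move=> k; rewrite big_split/= -mulr_suml -mulr_sumr h2m mulfK//.
    by rewrite /h1; ring.
  + move=> l; rewrite big_split/= -mulr_suml -mulr_suml h1m mulrAC divff//.
    by rewrite /h2; ring.
  + by move=> k l; rewrite addr_ge0// divr_ge0// mulr_ge0.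
- by move=> k; rewrite /h1 lerBlDr lerDl sumr_ge0.
- by move=> k; rewrite /h2 lerBlDr lerDl sumr_ge0.
Qed.

(** * Densities and the Donsker-Varadhan inequality *)

Section Density.
Context {dT} {T : measurableType dT} {R : realType}.

(** The proofs are arguments so that the probability structure declared below can be inferred from
    the term. *)
Definition density (mu : {measure set T -> \bar R}) (f : T -> R)
  (mf : measurable_fun setT f) (f0 : forall x, 0 <= f x)
  (f1 : (\int[mu]_x (f x)%:E = 1)%E) : set T -> \bar R :=
  fun A => (\int[mu]_(x in A) (f x)%:E)%E.

Section Instance.
Variables (mu : {measure set T -> \bar R}) (f : T -> R).
Hypotheses (mf : measurable_fun setT f) (f0 : forall x, 0 <= f x).
Hypothesis f1 : (\int[mu]_x (f x)%:E = 1)%E.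
Let nu := density mu f mf f0 f1.

Let nu0 : nu set0 = 0%E.
Proof. by rewrite /nu /density integral_set0. Qed.

Let nu_ge0 A : (0 <= nu A)%E.
Proof. by apply: integral_ge0 => x _; rewrite lee_fin. Qed.

Let nu_sigma_additive : semi_sigma_additive nu.
Proof.
apply: semi_sigma_additive_nng_induced; first exact/measurable_EFinP.
by move=> x; rewrite lee_fin.
Qed.

HB.instance Definition _ := isMeasure.Build _ _ _ (density mu f mf f0 f1)
  nu0 nu_ge0 nu_sigma_additive.
HB.instance Definition _ :=
  Measure_isProbability.Build _ _ _ (density mu f mf f0 f1) f1.

End Instance.

Section Theory.
Variables (mu : probability T R) (f : T -> R).
Hypotheses (mf : measurable_fun setT f) (f0 : forall x, 0 <= f x).
Hypothesis f1 : (\int[mu]_x (f x)%:E = 1)%E.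
Local Notation nu := (density mu f mf f0 f1).

Lemma density_dominates : nu `<< mu.
Proof.
apply/null_content_dominatesP => A mA muA0.
have mfA : measurable_fun A (EFin \o f) by apply/measurable_EFinP/measurable_funTS.
have := integral_abs_eq0 mA mfA muA0.
under eq_integral do rewrite /= ger0_norm//.
by [].
Qed.

Let f_integrable : mu.-integrable setT (EFin \o f).
Proof.
apply/integrableP; split; first exact/measurable_EFinP.
under eq_integral do rewrite /= ger0_norm//.
by rewrite f1 ltry.
Qed.

Lemma density_Radon_Nikodym :
  ae_eq mu setT (Radon_Nikodym (charge_of_finite_measure nu) mu) (EFin \o f).
Proof.
apply: integral_ae_eq => //.
- by apply: Radon_Nikodym_integrable; exact: density_dominates.
- exact/measurable_EFinP.
- move=> E _ mE; rewrite -Radon_Nikodym_integral//; exact: density_dominates.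
Qed.

Lemma integral_density (g : T -> \bar R) :
  measurable_fun setT g -> (forall x, 0 <= g x)%E ->
  (\int[nu]_x g x = \int[mu]_x (g x * (f x)%:E))%E.
Proof.
move=> mg g0; have nm := density_dominates.
rewrite -(Radon_Nikodym_SigmaFinite.change_of_variables nm)//.
have mRN := measurable_int _ (Radon_Nikodym_SigmaFinite.f_integrable nm).
apply: ge0_ae_eq_integral => //.
- exact: emeasurable_funM.
- by apply: emeasurable_funM => //; exact/measurable_EFinP.
- by move=> x _; rewrite mule_ge0//; exact: Radon_Nikodym_SigmaFinite.f_ge0.
- by move=> x _; rewrite mule_ge0// lee_fin.
apply: ae_eqe_mul2l; apply: integral_ae_eq => //.
- exact: Radon_Nikodym_SigmaFinite.f_integrable.
- exact/measurable_EFinP.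
- by move=> E _ mE; rewrite -Radon_Nikodym_SigmaFinite.f_integral.
Qed.

End Theory.
End Density.

Section BoundedIntegral.
Context {dT} {T : measurableType dT} {R : realType} (P : probability T R).

Lemma bounded_integrable (F : T -> R) (M : R) :
  measurable_fun setT F -> (forall x, `|F x| <= M) -> P.-integrable setT (EFin \o F).
Proof.
move=> mF FM; apply: measurable_bounded_integrable => //.
  by rewrite /= probability_setT ltry.
exists M; split; first exact: num_real.
by move=> y My x _ /=; exact: le_trans (FM x) (ltW My).
Qed.

Lemma integral_fin (F : T -> R) (M : R) :
  measurable_fun setT F -> (forall x, 0 <= F x <= M) ->
  exists2 I : R, 0 <= I <= M & (\int[P]_x (F x)%:E = I%:E)%E.
Proof.
move=> mF FM.
have mF' : measurable_fun setT (EFin \o F) by exact/measurable_EFinP.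
have I0 : (0 <= \int[P]_x (F x)%:E)%E.
  by apply: integral_ge0 => x _; rewrite lee_fin; case/andP: (FM x).
have IM : (\int[P]_x (F x)%:E <= M%:E)%E.
  apply: (@le_trans _ _ (\int[P]_x (cst M%:E x))%E).
    apply: ge0_le_integral => //.
    - by move=> x _; rewrite lee_fin; case/andP: (FM x).
    - by move=> x _ /=; rewrite lee_fin; case/andP: (FM x).
  rewrite integral_cst//.
  by rewrite /= probability_setT mule1.
exists (fine (\int[P]_x (F x)%:E)%E); last by rewrite fineK// ge0_fin_numE// (le_lt_trans IM)// ltry.
by rewrite fine_ge0//= -lee_fin fineK// ge0_fin_numE// (le_lt_trans IM)// ltry.
Qed.

End BoundedIntegral.

(** Meant for the entropy integrand, which is only known to lie above an integrable function. If its
    positive part has infinite integral, the right side is [+oo], because $h^-\le l^-$ has finite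
    integral. *)
Lemma le_integral_lower {dT} {T : measurableType dT} {R : realType}
    (P : {measure set T -> \bar R}) (l h : T -> \bar R) :
  P.-integrable setT l -> measurable_fun setT h -> (forall x, l x <= h x)%E ->
  (\int[P]_x l x <= \int[P]_x h x)%E.
Proof.
move=> il mh lh; have ml := measurable_int _ il.
have neg : (\int[P]_x h^\- x <= \int[P]_x l^\- x)%E.
  apply: ge0_le_integral => //; [exact: measurable_funeneg | exact: measurable_funeneg |].
  by move=> x _; rewrite !funenegE ge_max !le_max leeN2 lh lexx orbT.
have negoo : (\int[P]_x h^\- x < +oo)%E.
  by apply: (le_lt_trans neg); exact: integral_funeneg_lt_pinfty.
have [posoo|] := ltP (\int[P]_x h^\+ x)%E +oo%E.
  apply: le_integral => //; apply/integrableP; split => //.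
  under eq_integral => x _ do rewrite -/((abse \o h) x) fune_abse.
  rewrite ge0_integralD//; [|exact: measurable_funepos|exact: measurable_funeneg].
  by rewrite lte_add_pinfty.
rewrite leye_eq => /eqP pos; rewrite [leRHS]integralE pos.
by rewrite addye ?leey// eqe_oppLR/= lt_eqF.
Qed.

Section DonskerVaradhan.
Context {R : realType} {d : nat} (nu mu : probability (d.-tuple R) R).
Local Notation T := (d.-tuple R).

(** Let [t] be the logarithm of the quotient of the tilted density $e^\phi/Z$ by $d\nu/d\mu$. Then
    $1+t\le e^t$ bounds the log-density below by $\phi+1-\ln Z-e^t$, which is integrable, and $\int
    e^t\,d\nu\le 1$. *)
Lemma entropy_ge (phi : T -> R) (M Z I : R) :
  measurable_fun setT phi -> (forall x, `|phi x| <= M) -> 0 < Z ->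
  (\int[mu]_x (expR (phi x))%:E <= Z%:E)%E ->
  (\int[nu]_x (phi x)%:E = I%:E)%E ->
  ((I - ln Z)%:E <= entropy nu mu)%E.
Proof.
move=> mphi phiM Z0 phiZ phiI; rewrite /entropy.
case: asboolP => [nm|_]; last by rewrite leey.
(* This version of the derivative is finite and nonnegative everywhere; it agrees almost everywhere
   with the one in [entropy]. *)
pose RN := Radon_Nikodym_SigmaFinite.f nu mu.
have RNi : mu.-integrable setT RN by exact: Radon_Nikodym_SigmaFinite.f_integrable.
have RN0 x : (0 <= RN x)%E by exact: Radon_Nikodym_SigmaFinite.f_ge0.
have mRN : measurable_fun setT RN by exact: measurable_int RNi.
pose f x := fine (RN x).
have f0 x : 0 <= f x by exact: fine_ge0.
have RNf x : RN x = (f x)%:E.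
  by rewrite /f fineK//; exact: Radon_Nikodym_SigmaFinite.f_fin_num.
have mf : measurable_fun setT f by exact: measurableT_comp.
have mpos : measurable_fun setT (fun x => 0 < f x) by exact: measurable_fun_ltr.
have nupos : nu [set x | f x = 0] = 0%E.
  have mC : measurable [set x | f x = 0].
    rewrite (_ : [set _ | _] = setT `&` f @^-1` [set 0]) ?setTI//.
    by rewrite -[X in measurable X]setTI; exact: mf.
  rewrite (Radon_Nikodym_SigmaFinite.f_integral nm mC).
  by apply: integral0_eq => x /= fx; rewrite -/RN RNf fx.
(* On the [nu]-null set where [f] vanishes, the tilted density takes its place, which makes [t] zero
   there. *)
pose g x := if 0 < f x then f x else expR (phi x - ln Z).
have g0 x : 0 < g x by rewrite /g; case: ifPn => // _; exact: expR_gt0.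
have mg : measurable_fun setT g.
  apply: measurable_fun_ifT => //; apply: measurableT_comp => //.
  by apply: measurable_funD => //; exact: measurable_cst.
have mlng : measurable_fun setT (fun x => ln (g x)).
  by apply: measurableT_comp => //; exact: measurable_ln.
have mRN' : measurable_fun setT (Radon_Nikodym (charge_of_finite_measure nu) mu).
  by apply: (measurable_int mu); exact: Radon_Nikodym_integrable.
have -> : (\int[nu]_x (ln (fine (Radon_Nikodym (charge_of_finite_measure nu) mu x)))%:E =
   \int[nu]_x (ln (g x))%:E)%E.
  apply: ae_eq_integral => //.
  - apply/measurable_EFinP; apply: measurableT_comp; first exact: measurable_ln.
    exact: measurableT_comp.
  - exact/measurable_EFinP.
  have H1 : ae_eq nu setT RN (Radon_Nikodym (charge_of_finite_measure nu) mu).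
    apply: (null_dominates_ae_eq _ nm) => //.
    exact: ae_eq_Radon_Nikodym_SigmaFinite.
  have H2 : {ae nu, forall x, f x <> 0}.
    exists [set x | f x = 0]; split => //.
      rewrite (_ : [set _ | _] = setT `&` f @^-1` [set 0]) ?setTI//.
      by rewrite -[X in measurable X]setTI; exact: mf.
    by move=> x /= /contrapT.
  move: H1 H2; apply: filterS2 => x H1 H2 _.
  by rewrite -H1// /g lt_neqAle f0 andbT eq_sym; case: eqP.
pose t x := phi x - ln Z - ln (g x).
have mt : measurable_fun setT t.
  by apply: measurable_funB => //; apply: measurable_funB.
have mexpt : measurable_fun setT (fun x => expR (t x)).
  by apply: measurableT_comp.
have expt : (\int[nu]_x (expR (t x))%:E <= 1)%E.
  rewrite -(Radon_Nikodym_SigmaFinite.change_of_variables nm)//; last exact/measurable_EFinP.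
  apply: (@le_trans _ _ (\int[mu]_x ((Z^-1)%:E * (expR (phi x))%:E)))%E.
    apply: ge0_le_integral => //.
    - by move=> x _; apply: mule_ge0; [rewrite lee_fin expR_ge0 | exact: RN0].
    - by apply: emeasurable_funM => //; exact/measurable_EFinP.
    - apply: emeasurable_funM => //.
      by apply/measurable_EFinP; exact: measurableT_comp.
    move=> x _; rewrite -/RN RNf -!EFinM lee_fin /t /g.
    case: ifPn => fx; last first.
      have -> : f x = 0 by apply/eqP; rewrite eq_le f0 andbT leNgt.
      by rewrite mulr0 mulr_ge0 ?invr_ge0 ?expR_ge0// ltW.
    rewrite !expRD !expRN !lnK ?posrE// divfK ?gt_eqF//.
    by rewrite mulrC.
  have mep : measurable_fun setT (fun x => (expR (phi x))%:E).
    by apply/measurable_EFinP; exact: measurableT_comp.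
  have Z10 : (0 <= (Z^-1)%:E)%E by rewrite lee_fin invr_ge0 ltW.
  rewrite ge0_integralZl//.
  rewrite -[leRHS](_ : (Z^-1)%:E * Z%:E = 1)%E; last by rewrite -EFinM mulVf ?gt_eqF.
  by rewrite lee_wpmul2l// lee_fin invr_ge0 ltW.
have ephi : nu.-integrable setT (EFin \o phi) by exact: (@bounded_integrable _ _ _ _ _ M).
have eexp : nu.-integrable setT (fun x => (expR (t x))%:E).
  apply/integrableP; split; first exact/measurable_EFinP.
  under eq_integral do rewrite /= ger0_norm ?expR_ge0//.
  by rewrite (le_lt_trans expt)// ltry.
have ecst c : nu.-integrable setT (EFin \o cst c).
  by apply: finite_measure_integrable_cst.
have eu : nu.-integrable setT (fun x => (phi x)%:E + (1 - ln Z)%:E)%E.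
  exact: (@integrableD _ _ _ nu setT measurableT (EFin \o phi) (EFin \o cst (1 - ln Z))).
apply: (@le_trans _ _ (\int[nu]_x ((phi x)%:E + (1 - ln Z)%:E - (expR (t x))%:E)))%E.
  rewrite integralB// (@integralD _ _ _ nu setT measurableT (EFin \o phi) (EFin \o cst (1 - ln Z)))//.
  rewrite /= phiI (integral_cst _ measurableT) /=.
  rewrite probability_setT mule1.
  apply: (@le_trans _ _ (I%:E + (1 - ln Z)%:E - 1%:E))%E.
    apply: (@le_trans _ _ (I + (1 - ln Z) - 1)%:E); first by rewrite lee_fin; lra.
    exact: lexx.
  by rewrite leeB.
apply: le_integral_lower.
- exact: integrableB.
- exact/measurable_EFinP.
- move=> x; apply: (@le_trans _ _ (phi x + (1 - ln Z) - expR (t x))%:E); first exact: lexx.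
  rewrite lee_fin.
  by have := expR_ge1Dx (t x); rewrite /t; lra.
Qed.

Lemma entropy_ge0 : (0 <= entropy nu mu)%E.
Proof.
have := @entropy_ge (cst 0) 0 1 0 (measurable_cst _) _ ltr01.
rewrite ln1 subr0; apply.
- by move=> x; rewrite normr0.
- by rewrite /cst expR0 (integral_cst _ measurableT) /= probability_setT mule1.
- by rewrite integral0.
Qed.

End DonskerVaradhan.

(** * The dual inequality and its tensorization *)

Section Image.
Context {d1 d2} {T1 : measurableType d1} {T2 : measurableType d2} {R : realType}.

Lemma integral_image (P : {measure set T1 -> \bar R}) (Q : {measure set T2 -> \bar R})
    (f : T1 -> T2) (g : T2 -> \bar R) :
  measurable_fun setT f -> (forall A, measurable A -> Q A = P (f @^-1` A)) ->
  measurable_fun setT g -> (forall x, 0 <= g x)%E ->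
  (\int[Q]_x g x = \int[P]_x g (f x))%E.
Proof.
move=> mf QP mg g0.
transitivity (\int[pushforward P f]_x g x)%E.
  by apply: eq_measure_integral => A mA _; exact: QP.
by rewrite ge0_integral_pushforward// => y _; exact: g0.
Qed.

Lemma image_probability (P : probability T1 R) (f : T1 -> T2) :
  measurable_fun setT f ->
  exists Q : probability T2 R, forall A, measurable A -> Q A = P (f @^-1` A).
Proof.
move=> mf; pose f' : {mfun T1 >-> T2} := HB.pack f (isMeasurableFun.Build _ _ _ _ _ mf).
by exists (distribution P f').
Qed.

End Image.

Section Coupling.
Context {R : realType} {d : nat} (nu1 nu2 : probability (d.-tuple R) R).
Context (pi : probability (d.-tuple R * d.-tuple R)%type R).
Hypothesis cpi : coupling nu1 nu2 pi.

Lemma coupling_integral1 (g : d.-tuple R -> \bar R) :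
  measurable_fun setT g -> (forall x, 0 <= g x)%E ->
  (\int[pi]_z g z.1 = \int[nu1]_x g x)%E.
Proof.
move=> mg g0; rewrite (@integral_image _ _ _ _ _ pi nu1 fst)// => A mA.
transitivity (pi (A `*` setT)); first exact/esym/(cpi.1 A mA).
by congr (pi _); apply/seteqP; split => [x [] //|x /= ?]; split.
Qed.

Lemma coupling_integral2 (g : d.-tuple R -> \bar R) :
  measurable_fun setT g -> (forall x, 0 <= g x)%E ->
  (\int[pi]_z g z.2 = \int[nu2]_x g x)%E.
Proof.
move=> mg g0; rewrite (@integral_image _ _ _ _ _ pi nu2 snd)// => A mA.
transitivity (pi (setT `*` A)); first exact/esym/(cpi.2 A mA).
by congr (pi _); apply/seteqP; split => [x [] //|x /= ?]; split.
Qed.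

End Coupling.

(** Pairs [F], [G] stand in for a function and its infimal convolution, so that measurability of
    both is an assumption and not a delicate fact. The common bound [M] makes all integrals
    finite. *)
Definition dual_inequality {dT} {T : measurableType dT} {R : realType}
    (P : probability T R) (c : T -> T -> R) (C : R) :=
  forall (F G : T -> R) (M : R), measurable_fun setT F -> measurable_fun setT G ->
    (forall x, 0 <= F x <= M) -> (forall x, 0 <= G x <= M) ->
    (forall x y, F x - G y <= c x y) ->
  (\int[P]_x (expR (F x / C))%:E <= (expR (fine (\int[P]_x (G x)%:E) / C))%:E)%E.

Definition cost {R : realType} {d : nat} (p : R) (x y : d.-tuple R) : R :=
  \sum_(j < d) alpha p (tnth x j - tnth y j).

Lemma measurable_cost {R : realType} {d : nat} (p : R) :
  measurable_fun setT (fun z : d.-tuple R * d.-tuple R => cost p z.1 z.2).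
Proof.
apply: measurable_sum => j; apply: measurableT_comp; first exact: measurable_alpha.
apply: measurable_funB.
  exact: (measurableT_comp (measurable_tnth j) measurable_fst).
exact: (measurableT_comp (measurable_tnth j) measurable_snd).
Qed.

Lemma cost_ge0 {R : realType} {d : nat} (p : R) (x y : d.-tuple R) : 0 <= cost p x y.
Proof. by apply: sumr_ge0 => j _; exact: alpha_ge0. Qed.

Section ExpIntegral.
Context {dT} {T : measurableType dT} {R : realType} (P : probability T R).
Variables (F : T -> R) (M C : R).
Hypotheses (C0 : 0 < C) (mF : measurable_fun setT F) (FM : forall x, 0 <= F x <= M).

Lemma measurable_exp_div : measurable_fun setT (fun x => expR (F x / C)).
Proof.
by apply: measurableT_comp => //; apply: measurable_funM => //; exact: measurable_cst.
Qed.

Lemma exp_div_bound x : 1 <= expR (F x / C) <= expR (M / C).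
Proof.
have /andP[F0 FM'] := FM x.
apply/andP; split; first by rewrite -[leLHS]expR0 ler_expR divr_ge0// ltW.
by rewrite ler_expR ler_wpM2r// invr_ge0 ltW.
Qed.

Lemma exp_integral :
  exists2 Z : R, 1 <= Z <= expR (M / C) & (\int[P]_x (expR (F x / C))%:E = Z%:E)%E.
Proof.
have [] := integral_fin P _ (expR (M / C)) measurable_exp_div.
  by move=> x; have /andP[h1 ->] := exp_div_bound x; rewrite (le_trans ler01).
move=> Z /andP[Z0 ZM] ZE; exists Z => //; rewrite ZM andbT -lee_fin -ZE.
apply: (@le_trans _ _ (\int[P]_x (cst 1%E x))%E).
  by rewrite (integral_cst _ measurableT) /= probability_setT mule1.
apply: ge0_le_integral => //.
- by apply/measurable_EFinP; exact: measurable_exp_div.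
- by move=> x _; rewrite lee_fin; have /andP[] := exp_div_bound x.
Qed.

End ExpIntegral.

(** For the tilted [nu] the entropy is $\int F\,d\nu/C-\ln Z$, and every coupling costs at least
    $\int F\,d\nu-\int G\,d\mu$. In the transport inequality $\int F\,d\nu$ cancels and $\ln
    Z\le\int G\,d\mu/C$ remains. *)
Lemma transport_dual {R : realType} {d : nat} (mu : probability (d.-tuple R) R) (p C : R) :
  0 < C -> transport_entropy mu p C -> dual_inequality mu (cost p) C.
Proof.
move=> C0 TH F G M mF mG FM GM FG.
have [Z /andP[Z1 _] ZE] := exp_integral mu _ _ _ C0 mF FM.
have [IG _ IGE] := integral_fin mu _ _ mG GM.
rewrite ZE IGE /= lee_fin.
have Z0 : 0 < Z by exact: lt_le_trans Z1.
pose f x := expR (F x / C) / Z.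
have mf : measurable_fun setT f.
  by apply: measurable_funM; [exact: measurable_exp_div|exact: measurable_cst].
have f_gt0 x : 0 < f x by rewrite divr_gt0// expR_gt0.
have f0 x : 0 <= f x by exact: ltW.
have f1 : (\int[mu]_x (f x)%:E = 1)%E.
  under eq_integral do rewrite EFinM muleC.
  rewrite ge0_integralZl//.
  - by rewrite ZE -EFinM mulVf// gt_eqF.
  - by apply/measurable_EFinP; exact: measurable_exp_div.
  - by rewrite lee_fin invr_ge0 ltW.
pose nu : probability (d.-tuple R) R := density mu f mf f0 f1.
have [IF _ IFE] := integral_fin nu _ _ mF FM.
have numu : nu `<< mu by exact: density_dominates.
have entE : entropy nu mu = (IF / C - ln Z)%:E.
  rewrite /entropy; case: asboolP => // _.
  have mFE : nu.-integrable setT (EFin \o F).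
    apply: (@bounded_integrable _ _ _ _ _ M) => // x.
    by have /andP[F0 ?] := FM x; rewrite ger0_norm.
  transitivity (\int[nu]_x ((C^-1)%:E * (F x)%:E - (ln Z)%:E))%E.
    apply: ae_eq_integral => //.
    - apply/measurable_EFinP; apply: measurableT_comp; first exact: measurable_ln.
      by apply: measurableT_comp => //; apply: (measurable_int mu).
    - apply: emeasurable_funB; last exact: measurable_cst.
      by apply: emeasurable_funM; [exact: measurable_cst|exact/measurable_EFinP].
    apply: (null_dominates_ae_eq _ numu) => //.
    move: (density_Radon_Nikodym mu f mf f0 f1); apply: filterS => x H _.
    rewrite H//= /f ln_div ?posrE ?expR_gt0// expRK.
    by rewrite EFinB EFinM muleC.
  rewrite integralB//; last 2 first.
  - exact: integrableZl.
  - exact: finite_measure_integrable_cst.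
  rewrite integralZl// IFE (integral_cst _ measurableT) /= probability_setT mule1.
  by rewrite -EFinM mulrC.
have : ((IF - IG)%:E <= Tcost p nu mu)%E.
  apply: le_ereal_inf_tmp => _ [pi cpi <-].
  have mc := @measurable_cost R d p.
  have IFpi := coupling_integral1 _ _ _ cpi (EFin \o F).
  have IGpi := coupling_integral2 _ _ _ cpi (EFin \o G).
  have : (\int[pi]_z (F z.1)%:E <= \int[pi]_z ((cost p z.1 z.2)%:E + (G z.2)%:E))%E.
    apply: ge0_le_integral => //.
    - by move=> z _; rewrite lee_fin; case/andP: (FM z.1).
    - by apply/measurable_EFinP; exact: measurableT_comp.
    - apply: emeasurable_funD; first exact/measurable_EFinP.
      by apply/measurable_EFinP; exact: measurableT_comp.
    - by move=> z _; rewrite -EFinD lee_fin -lerBlDr.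
  rewrite ge0_integralD//; last 4 first.
  - by move=> z _; rewrite lee_fin cost_ge0.
  - exact/measurable_EFinP.
  - by move=> z _; rewrite lee_fin; case/andP: (GM z.2).
  - by apply/measurable_EFinP; exact: measurableT_comp.
  rewrite IFpi; [|exact/measurable_EFinP|by move=> x; rewrite lee_fin; case/andP: (FM x)].
  rewrite IGpi; [|exact/measurable_EFinP|by move=> x; rewrite lee_fin; case/andP: (GM x)].
  by rewrite /= IFE IGE EFinB leeBlDr.
move=> /le_trans/(_ (TH nu)); rewrite entE -EFinM lee_fin mulrBr mulrCA divff ?gt_eqF// mulr1.
move=> H; rewrite -[leLHS]lnK ?posrE// ler_expR ler_pdivlMr// mulrC; lra.
Qed.

Section Tensor.
Context {d1 d2} {T1 : measurableType d1} {T2 : measurableType d2} {R : realType}.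
Variables (P1 : probability T1 R) (P2 : probability T2 R) (C : R).
Variables (c1 : T1 -> T1 -> R) (c2 : T2 -> T2 -> R).
Hypotheses (C0 : 0 < C) (c20 : forall x y, 0 <= c2 x y).

Lemma dual_tensor : dual_inequality P1 c1 C -> dual_inequality P2 c2 C ->
  dual_inequality (P1 \x P2)%E (fun x y => c1 x.1 y.1 + c2 x.2 y.2) C.
Proof.
move=> D1 D2 F G M mF mG FM GM FG.
have mF2 y : measurable_fun setT (fun x => F (x, y)).
  by apply: measurableT_comp => //; exact: measurable_fun_pair.
have mG2 y : measurable_fun setT (fun x => G (x, y)).
  by apply: measurableT_comp => //; exact: measurable_fun_pair.
pose Z y := fine (\int[P1]_x (expR (F (x, y) / C))%:E)%E.
pose F' y := C * ln (Z y).
pose G' y := fine (\int[P1]_x (G (x, y))%:E)%E.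
have ZP y : 1 <= Z y <= expR (M / C) /\
    (\int[P1]_x (expR (F (x, y) / C))%:E = (Z y)%:E)%E.
  have [z z1 zE] := exp_integral P1 _ _ _ C0 (mF2 y) (fun x => FM (x, y)).
  by rewrite /Z zE.
have GP y : 0 <= G' y <= M /\ (\int[P1]_x (G (x, y))%:E = (G' y)%:E)%E.
  have [z z1 zE] := integral_fin P1 _ _ (mG2 y) (fun x => GM (x, y)).
  by rewrite /G' zE.
have Z0 y : 0 < Z y by have [/andP[z1 _] _] := ZP y; exact: lt_le_trans z1.
have M0 : 0 <= M.
  by have /andP[a b] := FM point; exact: le_trans b.
have mexpF := measurable_exp_div F C mF.
have mZ : measurable_fun setT Z.
  apply: measurableT_comp => //.
  apply: (@measurable_fun_fubini_tonelli_G _ _ _ _ _ P1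
    (fun z => (expR (F z / C))%:E)) => //; last exact/measurable_EFinP.
have mF' : measurable_fun setT F'.
  apply: measurable_funM; first exact: measurable_cst.
  by apply: measurableT_comp => //; exact: measurable_ln.
have mG' : measurable_fun setT G'.
  apply: measurableT_comp => //.
  apply: (@measurable_fun_fubini_tonelli_G _ _ _ _ _ P1 (EFin \o G)) => //.
    exact/measurable_EFinP.
  by move=> z; rewrite lee_fin; case/andP: (GM z).
have F'M y : 0 <= F' y <= M.
  have [/andP[z1 zM] _] := ZP y.
  apply/andP; split; first by rewrite /F' mulr_ge0 ?ln_ge0// ltW.
  by rewrite /F' mulrC -ler_pdivlMr// -[leRHS]expRK ler_ln// posrE// expR_gt0.
have G'M y : 0 <= G' y <= M by have [] := GP y.
(* The inequality for [P1] is applied to the slice of [F] at [x] and the slice of [G] at [y] raised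
   by the constant [c2 x y]; since this constant is nonnegative, the raised slice stays
   admissible. *)
have F'G' x y : F' x - G' y <= c2 x y.
  have mGc : measurable_fun setT (fun z => G (z, y) + c2 x y).
    by apply: measurable_funD => //; exact: measurable_cst.
  have := D1 (fun z => F (z, x)) (fun z => G (z, y) + c2 x y) (M + c2 x y)
    (mF2 x) mGc.
  have [_ ->] := ZP x.
  under eq_integral do rewrite EFinD.
  rewrite ge0_integralD//; last 3 first.
  - by move=> z _; rewrite lee_fin; case/andP: (GM (z, y)).
  - exact/measurable_EFinP.
  - by move=> z _; rewrite lee_fin.
  rewrite (integral_cst _ measurableT) /= probability_setT mule1.
  have [_ ->] := GP y; rewrite -EFinD /= lee_fin => H.
  have {}H : Z x <= expR ((G' y + c2 x y) / C).
    apply: H => [z|z|z z'].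
    - by have /andP[-> h] := FM (z, x); rewrite (le_trans h)// lerDl.
    - by have /andP[h1 h2] := GM (z, y); rewrite addr_ge0//= lerD2r.
    - by have := FG (z, x) (z', y); rewrite /=; lra.
  by rewrite lerBlDl /F' mulrC -ler_pdivlMr// -[leRHS]expRK ler_ln// posrE// expR_gt0.
have := D2 F' G' M mF' mG' F'M G'M F'G'.
rewrite fubini_tonelli2//; last exact/measurable_EFinP.
rewrite (@fubini_tonelli2 _ _ _ _ _ _ _ (EFin \o G))//; last 2 first.
- exact/measurable_EFinP.
- by move=> z; rewrite lee_fin; case/andP: (GM z).
congr (_ <= _)%E.
  apply: eq_integral => y _; rewrite /fubini_G; have [_ ->] := ZP y.
  by rewrite /F' mulrC mulKf ?gt_eqF// lnK// posrE.
congr (expR (fine _ / C))%:E.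
by apply: eq_integral => y _; rewrite /fubini_G /=; have [_ ->] := GP y.
Qed.

End Tensor.

Lemma dual_image {d1 d2} {T1 : measurableType d1} {T2 : measurableType d2} {R : realType}
    (P : probability T1 R) (Q : probability T2 R) (f : T1 -> T2) c1 c2 (C : R) :
  0 < C ->
  measurable_fun setT f -> (forall A, measurable A -> Q A = P (f @^-1` A)) ->
  (forall x y, c2 (f x) (f y) <= c1 x y) ->
  dual_inequality P c1 C -> dual_inequality Q c2 C.
Proof.
move=> C0 mf QP cc D F G M mF mG FM GM FG.
rewrite (integral_image P Q f)//; last first.
  by apply/measurable_EFinP; exact: measurable_exp_div.
rewrite (integral_image P Q f (EFin \o G))//; last 2 first.
- exact/measurable_EFinP.
- by move=> x; rewrite lee_fin; case/andP: (GM x).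
apply: (D (F \o f) (G \o f) M) => [| |x|x|x y].
- exact: measurableT_comp.
- exact: measurableT_comp.
- exact: FM.
- exact: GM.
- exact: le_trans (FG _ _) (cc _ _).
Qed.

(** * Product measures on tuples *)

Definition box {T : Type} {n : nat} (A : 'I_n -> set T) : set (n.-tuple T) :=
  [set x | forall i, A i (tnth x i)].

Lemma measurable_box {dT} {T : measurableType dT} {n} (A : 'I_n -> set T) :
  (forall i, measurable (A i)) -> measurable (box A).
Proof.
move=> mA.
rewrite (_ : box A = \big[setI/setT]_(i < n) (@tnth n T ^~ i @^-1` A i)).
  apply: bigsetI_measurable => i _; rewrite -[X in measurable X]setTI.
  exact: measurable_tnth.
apply/seteqP; split => [x Ax|x].
  by rewrite -bigcap_seq => i _; exact: Ax.
by rewrite -bigcap_seq => Ax i; apply: Ax; rewrite /= mem_index_enum.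
Qed.

Section ProductMeasure.
Context {R : realType} {d : nat} (mu : probability (d.-tuple R) R).
Local Notation T := (d.-tuple R).

(** Boxes are stable under intersection and generate the sigma-algebra, and [is_product] prescribes
    their masses. Any product law can thus be exchanged for the one built with [tcons]. *)
Lemma product_unique n (P Q : probability (n.-tuple T) R) :
  is_product mu P -> is_product mu Q -> forall A, measurable A -> P A = Q A.
Proof.
move=> prP prQ.
pose G := [set B : set (n.-tuple T) | exists2 A, (forall i, measurable (A i)) & B = box A].
apply: (measure_unique G (fun=> setT)).
- rewrite eqEsubset; split.
    apply: smallest_sub; first exact: smallest_sigma_algebra.
    rewrite -bigcup_seq; apply: bigcup_sub => i _ _ [B mB <-].
    apply: sub_sigma_algebra.
    exists (fun j => if j == i then B else setT).
      by move=> j; case: ifP.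
    apply/seteqP; split => [x [_ Bx] j|x Bx] /=.
      by case: eqP => // ->.
    by split => //; have := Bx i; rewrite eqxx.
  apply: smallest_sub; first exact: sigma_algebra_measurable.
  by move=> _ [A mA ->]; exact: measurable_box.
- move=> _ _ [A mA ->] [B mB ->]; exists (fun i => A i `&` B i).
    by move=> i; exact: measurableI.
  apply/seteqP; split => [x [Ax Bx] i|x ABx]; first by split.
  by split => i; have [] := ABx i.
- by move=> _; exists (fun=> setT) => //; apply/seteqP; split.
- by rewrite bigcup_const//; exists 0%N.
- by move=> _ [A mA ->]; exact: etrans (prP _ mA) (esym (prQ _ mA)).
- by move=> _; rewrite /= probability_setT ltry.
Qed.

Definition tcons {n} (z : T * n.-tuple T) : n.+1.-tuple T := [tuple of z.1 :: z.2].

Lemma measurable_tcons n : measurable_fun setT (@tcons n).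
Proof. exact: measurable_cons. Qed.

Lemma product_tcons n (P : probability (n.-tuple T) R)
    (Q : probability (n.+1.-tuple T) R) :
  is_product mu P ->
  (forall A, measurable A -> Q A = (mu \x P)%E (@tcons n @^-1` A)) -> is_product mu Q.
Proof.
move=> prP QE A mA; rewrite -/(box A) QE; last exact: measurable_box.
rewrite (_ : _ @^-1` _ = A ord0 `*` box (fun i => A (lift ord0 i))).
  rewrite product_measure1E//; last by apply: measurable_box.
  by rewrite big_ord_recl; congr (_ * _)%E; apply: prP.
apply/seteqP; split => [[x y] /= H|[x y] /= [Hx Hy] i].
  split; first by have := H ord0.
  by move=> i; have := H (lift ord0 i); rewrite /tcons tnthS.
by have [j ->|->] := unliftP ord0 i; rewrite /tcons ?tnthS ?tnth0//; exact: Hy.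
Qed.

Lemma product_exists n : exists P : probability (n.-tuple T) R, is_product mu P.
Proof.
elim: n => [|n [P prP]].
  exists (dirac [tuple]) => A mA; rewrite big_ord0 /= /dirac indicE mem_set//.
  by case.
have [Q QE] := image_probability (mu \x P)%E _ (measurable_tcons n).
by exists Q; exact: product_tcons QE.
Qed.

Lemma dual_product (p C : R) n (P : probability (n.-tuple T) R) :
  0 < C -> dual_inequality mu (cost p) C -> is_product mu P ->
  dual_inequality P (ncost p) C.
Proof.
move=> C0 D; elim: n P => [|n IH] P prP.
  move=> F G M mF mG FM GM FG.
  have -> : (fun x => (expR (F x / C))%:E) = cst (expR (F [tuple] / C))%:E.
    by apply/funext => x; rewrite (tuple0 x).
  have -> : (fun x => (G x)%:E) = cst (G [tuple])%:E.
    by apply/funext => x; rewrite (tuple0 x).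
  rewrite !(integral_cst _ measurableT) /= probability_setT !mule1.
  rewrite lee_fin ler_expR ler_wpM2r ?invr_ge0 ?(ltW C0)//.
  by rewrite -subr_le0 (le_trans (FG _ _))// /ncost big_ord0.
have [Pn prPn] := product_exists n.
have [Q QE] := image_probability (mu \x Pn)%E _ (measurable_tcons n).
have prQ := product_tcons _ _ _ prPn QE.
have PE A : measurable A -> P A = (mu \x Pn)%E (@tcons n @^-1` A).
  by move=> mA; rewrite -QE//; exact: product_unique.
apply: (dual_image _ _ _ _ _ _ C0 (measurable_tcons n) PE _
  (dual_tensor _ _ _ _ _ C0 _ D (IH _ prPn))).
- move=> x y; rewrite /ncost big_ord_recl /cost lerD//.
  apply: ler_sum => i _; apply: ler_sum => j _.
  by rewrite /Defs.coord /tcons !tnthS.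
- by move=> x y; do 2 (apply: sumr_ge0 => ? _); exact: alpha_ge0.
Qed.

(** The dual inequality reads $e^{r/C}P(B^c)\le e^{rP(A^c)/C}$. As $P(A^c)\le 1/2$, half of the
    exponent survives, which is the rate $1/(2C)$. *)
Lemma transport_concentration (p C : R) : 1 <= p <= 2 -> 0 < C ->
  transport_entropy mu p C -> concentration mu p (1 / (2 * C)) 2.
Proof.
move=> p12 C0 TH n n0 P prP A mA PA r r0.
apply: le_ereal_inf_tmp => _ [B [mB AB] <-].
have D := dual_product p _ _ P C0 (transport_dual _ _ _ C0 TH) prP.
have mnA : measurable (~` A) by exact: measurableC.
have mnB : measurable (~` B) by exact: measurableC.
have ind01 (S : set (n.-tuple T)) x : 0 <= r * \1_S x <= r.
  by rewrite indicE; case: (_ \in _); rewrite ?mulr1 ?mulr0 ?r0 lexx.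
have mind (S : set (n.-tuple T)) : measurable S ->
    measurable_fun setT (fun x => r * \1_S x).
  by move=> mS; apply: measurable_funM; [exact: measurable_cst|exact: measurable_indic].
have intG : (\int[P]_x (r * \1_(~` A) x)%:E = r%:E * P (~` A))%E.
  under eq_integral do rewrite EFinM.
  rewrite ge0_integralZl//; first by rewrite integral_indic// setIT.
  by apply/measurable_EFinP; exact: measurable_indic.
have PAr : P A = (fine (P A))%:E by rewrite fineK// fin_num_measure.
have PBr : P B = (fine (P B))%:E by rewrite fineK// fin_num_measure.
have PAC := probability_setC P mA; have PBC := probability_setC P mB.
have := D _ _ r (mind _ mnB) (mind _ mnA) (ind01 _) (ind01 _).
move=> /(_ _)/wrap[x y|].
  (* The essential case is [y] in [A] and [x] outside [B]: a cost below [r] would put [x] into the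
     enlargement, hence into [B]. *)
  have xy0 : 0 <= ncost p x y.
    by do 2 (apply: sumr_ge0 => ? _); exact: alpha_ge0.
  have [yA|yA] := pselect (A y); last first.
    rewrite [X in _ - r * X]indicE mem_set// mulr1.
    by rewrite (le_trans _ xy0)// subr_le0; case/andP: (ind01 (~` B) x).
  rewrite [X in _ - r * X]indicE memNset; last by [].
  rewrite mulr0 subr0 indicE.
  have [xB|xB] := pselect (B x).
    by rewrite memNset ?mulr0//.
  rewrite mem_set// mulr1 leNgt; apply/negP => rxy; apply: xB; apply: AB.
  exact: ncost_enlarge (ltW rxy).
rewrite intG PAC PAr -EFinB -EFinM /= => H.
have : ((expR (r / C))%:E * P (~` B) <= (expR (r * (1 - fine (P A)) / C))%:E)%E.
  apply: le_trans H.
  have -> : ((expR (r / C))%:E * P (~` B) =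
      \int[P]_x ((expR (r / C))%:E * (\1_(~` B) x)%:E))%E.
    rewrite ge0_integralZl//; first by rewrite integral_indic// setIT.
    by apply/measurable_EFinP; exact: measurable_indic.
  apply: ge0_le_integral => //.
  - apply: emeasurable_funM => //; apply/measurable_EFinP.
    exact: measurable_indic.
  - by apply/measurable_EFinP; apply: measurable_exp_div; exact: mind.
  - move=> x _; rewrite -EFinM lee_fin indicE.
    by case: (_ \in _); rewrite ?mulr1 // mulr0 expR_ge0.
rewrite PBC PBr -EFinB -EFinM !lee_fin => {}H.
move: PA; rewrite PAr lee_fin => PA.
have e1 : expR (r * (1 - fine (P A)) / C) <= expR (r / C) * expR (- (1 / (2 * C) * r)).
  rewrite -expRD ler_expR.
  rewrite (_ : r / C + _ = r * (1 - 2^-1) / C); last by field; rewrite gt_eqF.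
  by rewrite ler_wpM2r ?invr_ge0 ?(ltW C0)// ler_wpM2l//; lra.
have := le_trans H e1; rewrite ler_pM2l ?expR_gt0// => {}H.
(* The bound obtained has factor 1 before the exponential; the factor 2 is weaker. *)
have := expR_gt0 (- (1 / (2 * C) * r)); lra.
Qed.

End ProductMeasure.

(** * Quantization and tail estimates *)

Definition cell_mass {dT} {T : measurableType dT} {R : realType} {K : finType}
  (q : T -> K) (P : probability T R) (k : K) : R := fine (P (q @^-1` [set k])).

Section Quantizer.
Context {dT} {T : measurableType dT} {R : realType} {K : finType} (q : T -> K).
Hypothesis mq : forall k, measurable (q @^-1` [set k]).

Lemma measurable_quantized_set (S : pred K) : measurable [set x | S (q x)].
Proof.
rewrite (_ : [set _ | _] = \big[setU/set0]_(k | S k) (q @^-1` [set k])).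
  by apply: bigsetU_measurable => k _.
rewrite -bigcup_seq_cond; apply/seteqP; split => [x /= Sx|x [k /= /andP[_ Sk] ->]//].
by exists (q x) => //=; rewrite mem_index_enum.
Qed.

Lemma measurable_quantized {d2} {T2 : measurableType d2} (g : K -> T2) :
  measurable_fun setT (g \o q).
Proof.
move=> _ Y mY; rewrite setTI.
rewrite (_ : _ @^-1` Y = [set x | [pred k | `[< Y (g k) >]] (q x)]).
  exact: measurable_quantized_set.
by apply/seteqP; split => x /=; [move=> ?; apply/asboolP|move/asboolP].
Qed.

Variable P : probability T R.
Local Notation pk := (cell_mass q P).

Lemma cell_massE k : P (q @^-1` [set k]) = (pk k)%:E.
Proof. by rewrite /cell_mass fineK// fin_num_measure. Qed.

Lemma cell_mass_ge0 k : 0 <= pk k.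
Proof. exact: fine_ge0. Qed.

Lemma integral_quantized (g : K -> R) : (forall k, 0 <= g k) ->
  (\int[P]_x (g (q x))%:E = (\sum_k g k * pk k)%:E)%E.
Proof.
move=> g0.
transitivity (\int[P]_x (\sum_(k <- index_enum K) (g k)%:E * (\1_(q @^-1` [set k]) x)%:E))%E.
  apply: eq_integral => x _; rewrite (bigD1_seq (q x))/= ?mem_index_enum ?index_enum_uniq//.
  rewrite indicE mem_set// mule1 big1 ?adde0// => k kq.
  by rewrite indicE memNset ?mule0//= => qk; move: kq; rewrite qk eqxx.
rewrite ge0_integral_sum//; last 2 first.
- move=> k; apply: emeasurable_funM => //; apply/measurable_EFinP.
  exact: measurable_indic.
- by move=> k x _; rewrite mule_ge0 ?lee_fin// indicE.
rewrite -sumEFin; apply: eq_bigr => k _.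
rewrite ge0_integralZl//; last 2 first.
- by apply/measurable_EFinP; exact: measurable_indic.
- by rewrite lee_fin.
by rewrite integral_indic// setIT /= cell_massE EFinM.
Qed.

Lemma sum_cell_mass : \sum_k pk k = 1.
Proof.
have := integral_quantized (fun=> 1) (fun=> ler01).
rewrite (integral_cst _ measurableT) /= probability_setT mule1 => -[->].
by apply: eq_bigr => k _; rewrite mul1r.
Qed.

Lemma prob_quantized (S : pred K) :
  P [set x | S (q x)] = (\sum_(k | S k) pk k)%:E.
Proof.
have mS := measurable_quantized_set S.
transitivity (\int[P]_x ((S (q x))%:R)%:E)%E.
  rewrite -[LHS](_ : (\int[P]_x (\1_[set x | S (q x)] x)%:E)%E = _); last first.
    by rewrite integral_indic// setIT.
  apply: eq_integral => x _; rewrite indicE; congr (_%:R)%:E.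
  by congr nat_of_bool; exact: asboolb.
rewrite (integral_quantized (fun k => (S k)%:R))//; congr (_%:E).
by rewrite [RHS]big_mkcond; apply: eq_bigr => k _; case: (S k); rewrite ?mul1r ?mul0r.
Qed.

End Quantizer.

Section TupleQuantizer.
Context {R : realType} {d : nat} {K : finType} (q : d.-tuple R -> K).
Hypothesis mq : forall k, measurable (q @^-1` [set k]).

Definition quantize n (x : n.-tuple (d.-tuple R)) : {ffun 'I_n -> K} :=
  [ffun i => q (tnth x i)].

Lemma quantize_cell n (s : {ffun 'I_n -> K}) :
  quantize n @^-1` [set s] = box (fun i => q @^-1` [set s i]).
Proof.
apply/seteqP; split => [x /= <- i /=|x /= H]; first by rewrite ffunE.
by apply/ffunP => i; rewrite ffunE; exact: H.
Qed.

Lemma measurable_quantize n (s : {ffun 'I_n -> K}) :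
  measurable (quantize n @^-1` [set s]).
Proof. by rewrite quantize_cell; apply: measurable_box => i. Qed.

(** Cells of tuples are boxes, so estimates on typical samples under the product law become finite
    sums of [wprod]. *)
Lemma cell_mass_quantize n (mu : probability (d.-tuple R) R) P
    (s : {ffun 'I_n -> K}) :
  is_product mu P -> cell_mass (quantize n) P s = wprod (cell_mass q mu) n s.
Proof.
move=> prP; rewrite /cell_mass quantize_cell.
have -> : P (box (fun i => q @^-1` [set s i])) = (\prod_(i < n) mu (q @^-1` [set s i]))%E.
  exact: prP.
rewrite (eq_bigr (fun i => (cell_mass q mu (s i))%:E)); last by move=> i _; rewrite cell_massE.
by rewrite prodEFin.
Qed.

End TupleQuantizer.

(** * Tail probabilities, truncations and exponential moments *)

Section Tails.
Context {dT} {T : measurableType dT} {R : realType} (P : probability T R).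
Variable h : T -> R.
Hypotheses (mh : measurable_fun setT h).

Lemma measurable_superlevel (t : R) : measurable [set x | t < h x].
Proof.
rewrite (_ : [set _ | _] = setT `&` (fun x => cst t x < h x) @^-1` [set true]).
  by apply: measurable_fun_ltr.
by rewrite setTI.
Qed.

Lemma prob_tail (e : R) : 0 < e -> \forall n \near \oo, (P [set x | n%:R < h x]%R <= e%:E)%E.
Proof.
move=> e0; pose F n := [set x | n%:R < h x].
have mF n : measurable (F n) by exact: measurable_superlevel.
have F0 : \bigcap_n F n = set0.
  rewrite -subset0 => x /(_ (Num.truncn (h x)).+1 I) /=.
  by move=> H; have := lt_trans (truncnS_gt (h x)) H; rewrite ltxx.
have : P \o F @ \oo --> P (\bigcap_n F n).
  apply: nonincreasing_cvg_mu => //.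
  - by rewrite ltey_eq fin_num_measure.
  - by rewrite F0.
  - move=> n m nm; apply/subsetPset => x /=; apply: le_lt_trans.
    by rewrite ler_nat.
rewrite F0 measure0 => /fine_cvgP[_] /cvgrPdist_le /(_ e e0).
apply: filterS => n; rewrite /= sub0r normrN ger0_norm ?fine_ge0//.
by rewrite -lee_fin fineK// fin_num_measure.
Qed.

Hypothesis h0 : forall x, 0 <= h x.

(** Monotone convergence; the levels [s * n + c] are those at which exponential moments will be
    bounded. *)
Lemma integrable_truncation (B c s : R) : 0 < s -> 0 <= c ->
  (forall n : nat, (\int[P]_x (Num.min (h x) (s * n%:R + c))%:E <= B%:E)%E) ->
  P.-integrable setT (EFin \o h).
Proof.
move=> s0 c0 HB; have mhE : measurable_fun setT (EFin \o h) by exact/measurable_EFinP.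
apply/integrableP; split => //.
under eq_integral do rewrite /= ger0_norm//.
have mmin n : measurable_fun setT (fun x => (Num.min (h x) (s * n%:R + c))%:E).
  by apply/measurable_EFinP; apply: measurable_minr => //; exact: measurable_cst.
apply: (@le_lt_trans _ _ B%:E); last exact: ltry.
have -> : (\int[P]_x (h x)%:E = \int[P]_x limn (fun n => (Num.min (h x) (s * n%:R + c))%:E))%E.
  apply: eq_integral => x _; apply/esym/cvg_lim => //.
  apply: cvg_near_cst; exists (Num.truncn (h x / s)).+1 => // n /= nx.
  congr (_%:E); apply/min_idPl.
  have : h x / s < n%:R by rewrite (lt_le_trans (truncnS_gt _))// ler_nat.
  by rewrite ltr_pdivrMr// mulrC => /ltW; lra.
rewrite monotone_convergence//; last 2 first.
- by move=> n x _; rewrite lee_fin le_min h0 addr_ge0// mulr_ge0// ltW.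
- move=> x _ m n mn; rewrite lee_fin le_min !ge_min lexx/=; apply/orP; right.
  by rewrite lerD2r ler_wpM2l ?ler_nat// ltW.
apply: lime_le; last by apply: nearW => n; exact: HB.
apply: ereal_nondecreasing_is_cvgn => m n mn; apply: ge0_le_integral => //.
- by move=> x _; rewrite lee_fin le_min h0 addr_ge0// mulr_ge0// ltW.
- move=> x _; rewrite lee_fin le_min !ge_min lexx/=; apply/orP; right.
  by rewrite lerD2r ler_wpM2l ?ler_nat// ltW.
Qed.

Lemma integrable_tail (e : R) : P.-integrable setT (EFin \o h) -> 0 < e ->
  \forall n \near \oo, (\int[P]_x (h x * (n%:R < h x)%R%:R)%:E <= e%:E)%E.
Proof.
move=> ih e0.
have mf n : measurable_fun setT (fun x => (h x * (n%:R < h x)%R%:R)%:E).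
  apply/measurable_EFinP; apply: measurable_funM => //.
  rewrite (_ : (fun x => _) = \1_[set x | n%:R < h x]).
    by apply: measurable_indic; exact: measurable_superlevel.
  by apply/funext => x; rewrite indicE; congr (_%:R); congr nat_of_bool; exact/esym/asboolb.
have ptw : {ae P, forall x, setT x ->
    (fun n : nat => (h x * (n%:R < h x)%R%:R)%:E) @ \oo --> 0%E}.
  apply: aeW => x _; apply: cvg_near_cst.
  exists (Num.truncn (h x)).+1 => // n /= nx.
  rewrite ltNge ltW ?mulr0//; rewrite (lt_le_trans (truncnS_gt _))// ler_nat.
  exact: nx.
have dom : {ae P, forall x, forall n : nat, setT x ->
    (`|(h x * (n%:R < h x)%R%:R)%:E| <= (h x)%:E)%E}.
  apply: aeW => x n _; rewrite /= lee_fin ger0_norm ?mulr_ge0//.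
  by case: (_ < _)%R; rewrite ?mulr1 ?mulr0.
have [_ _] := dominated_convergence measurableT mf (measurable_cst 0%E) ptw ih dom.
rewrite integral0 => /fine_cvgP[finn] /cvgrPdist_le /(_ e e0).
move=> H; near=> n.
have finn' : (\int[P]_x (h x * (n%:R < h x)%R%:R)%:E)%E \is a fin_num by near: n.
rewrite -(fineK finn') lee_fin.
have : `|0 - fine (\int[P]_x (h x * (n%:R < h x)%R%:R)%:E)%E| <= e by near: n.
by rewrite sub0r normrN; apply: le_trans; exact: ler_norm.
Unshelve. all: by end_near. Qed.

(** Layer-cake sum in steps of length [s]: up to the factor $e^{cc_0}$, crossing the level $sk+c_0$
    adds at most $e^{a(k+1)/2}$ to the bound, on an event of mass at most $be^{-ak}$. The resulting
    geometric series bounds all truncations by the same [B]. *)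
Lemma exp_moment_truncation (a b s c0 : R) : 0 < a -> 0 <= b -> 0 < s -> 0 <= c0 ->
  (forall k : nat, (P [set x | s * k%:R + c0 < h x]%R <= (b * expR (- (a * k%:R)))%:E)%E) ->
  exists2 B : R, 0 < B & forall n : nat,
   (\int[P]_x (expR (a / (2 * s) * Num.min (h x) (s * n%:R + c0)))%:E <= B%:E)%E.
Proof.
move=> a0 b0 s0 c00 tail.
(* Half of the critical rate $a/s$, which leaves the ratio $e^{-a/2}$ for the series. *)
set c := a / (2 * s); have c_gt0 : 0 < c by rewrite divr_gt0// mulr_gt0.
have cs : c * s = a / 2 by rewrite /c; field; rewrite gt_eqF.
pose rho := expR (- (a / 2)).
have rho1 : rho < 1 by rewrite -expR0 ltr_expR; lra.
have rho0 : 0 < rho by exact: expR_gt0.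
pose J k x : R := (s * k%:R + c0 < h x)%R%:R.
have JE k : J k = \1_[set x | s * k%:R + c0 < h x].
  by apply/funext => x; rewrite indicE /J; congr (_%:R); congr nat_of_bool; exact/esym/asboolb.
have mJ k : measurable_fun setT (J k).
  by rewrite JE; apply: measurable_indic; exact: measurable_superlevel.
have ptw n x : expR (c * Num.min (h x) (s * n%:R + c0)) <=
    expR (c * c0) * (1 + \sum_(k < n) expR (a / 2 * k.+1%:R) * J k x).
  elim: n => [|n IH].
    rewrite big_ord0 addr0 mulr1 ler_expR ler_wpM2l ?(ltW c_gt0)//.
    by rewrite ge_min mulr0 add0r lexx orbT.
  rewrite big_ord_recr/=.
  have [hx|hx] := leP (h x) (s * n%:R + c0).
    have -> : Num.min (h x) (s * n.+1%:R + c0) = Num.min (h x) (s * n%:R + c0).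
      by rewrite !(min_idPl _)// (le_trans hx)// lerD2r ler_wpM2l ?ler_nat ?(ltW s0).
    by rewrite (le_trans IH)// ler_wpM2l ?expR_ge0// lerD2l lerDl mulr_ge0// expR_ge0.
  apply: (@le_trans _ _ (expR (c * c0) * expR (a / 2 * n.+1%:R))).
    rewrite -expRD ler_expR -cs -mulrA -mulrDr ler_wpM2l ?(ltW c_gt0)//.
    by rewrite ge_min addrC lexx orbT.
  rewrite ler_wpM2l ?expR_ge0// {2}/J hx mulr1 addrA lerDr addr_ge0// sumr_ge0// => k _.
  by rewrite mulr_ge0// expR_ge0.
pose B := expR (c * c0) * (1 + b * expR (a / 2) / (1 - rho)).
have B0 : 0 < B.
  rewrite mulr_gt0 ?expR_gt0// ltr_pwDl// divr_ge0 ?mulr_ge0 ?expR_ge0//; lra.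
exists B => // n.
have mS : measurable_fun setT (fun x => \sum_(k < n) expR (a / 2 * k.+1%:R) * J k x).
  by apply: measurable_sum => k; apply: measurable_funM => //; exact: measurable_cst.
apply: (@le_trans _ _ (\int[P]_x ((expR (c * c0))%:E * (1 + \sum_(k < n)
   ((expR (a / 2 * k.+1%:R))%:E * (J k x)%:E))))%E).
  apply: ge0_le_integral => //.
  - apply/measurable_EFinP; apply: measurableT_comp => //.
    apply: measurable_funM; first exact: measurable_cst.
    by apply: measurable_minr => //; exact: measurable_cst.
  - apply: emeasurable_funM => //; apply: emeasurable_funD => //.
    apply: emeasurable_sum => k; apply: emeasurable_funM => //.
    exact/measurable_EFinP.
  - move=> x _; under eq_bigr do rewrite -EFinM.
    by rewrite sumEFin -EFinD -EFinM lee_fin.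
have mT (k : 'I_n) : measurable_fun setT (fun x => ((expR (a / 2 * k.+1%:R))%:E * (J k x)%:E)%E).
  by apply: emeasurable_funM => //; exact/measurable_EFinP.
have nnT (k : 'I_n) x : (0 <= (expR (a / 2 * k.+1%:R))%:E * (J k x)%:E)%E.
  by rewrite mule_ge0// lee_fin ?expR_ge0.
have mTs : measurable_fun setT (fun x => \sum_(k < n) ((expR (a / 2 * k.+1%:R))%:E * (J k x)%:E))%E.
  exact: emeasurable_sum.
rewrite ge0_integralZl//; last 2 first.
- by apply: emeasurable_funD.
- by move=> x _; rewrite adde_ge0// sume_ge0.
rewrite ge0_integralD//; last first.
  by move=> x _; rewrite sume_ge0.
rewrite (integral_cst _ measurableT) /= probability_setT mule1.
rewrite ge0_integral_sum; [|by []|exact: mT|by move=> k x _; exact: nnT].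
rewrite /B EFinM lee_wpmul2l ?lee_fin ?expR_ge0// EFinD leeD2l//.
apply: (@le_trans _ _ (\sum_(k < n) (b * expR (a / 2) * rho ^+ k)%:E))%E.
  apply: lee_sum => k _; rewrite ge0_integralZl//; last 2 first.
  - exact/measurable_EFinP.
  - by move=> x _; rewrite lee_fin.
  rewrite JE integral_indic ?setIT//; last exact: measurable_superlevel.
  apply: (@le_trans _ _ ((expR (a / 2 * k.+1%:R))%:E * (b * expR (- (a * k%:R)))%:E))%E.
    by rewrite lee_wpmul2l//; exact: tail.
  rewrite -EFinM lee_fin (_ : _ * (b * _) = b * expR (a / 2) * rho ^+ k)//.
  rewrite mulrCA -[in RHS]mulrA; congr (b * _).
  by rewrite /rho -expRM_natl -!expRD -natr1; congr expR; field.
rewrite sumEFin lee_fin -mulr_sumr ler_wpM2l ?mulr_ge0 ?expR_ge0//.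
rewrite -[leRHS]mul1r ler_pdivlMr ?subr_gt0// mulrC.
have := subrX1 rho n => H; have : 0 <= rho ^+ n by rewrite exprn_ge0// ltW.
by nra.
Qed.

End Tails.

(** * Integrability of the cost under concentration *)

Section Radius.
Context {R : realType} {d : nat} (p : R).
Local Notation T := (d.-tuple R).

Definition origin_cost (x : T) : R := \sum_(j < d) alpha p (tnth x j).

Lemma origin_cost_ge0 x : 0 <= origin_cost x.
Proof. by apply: sumr_ge0 => j _; exact: alpha_ge0. Qed.

Lemma measurable_origin_cost : measurable_fun setT origin_cost.
Proof.
apply: measurable_sum => j.
exact: (measurableT_comp (measurable_alpha p) (measurable_tnth j)).
Qed.

Hypothesis p12 : 1 <= p <= 2.

Lemma cost_le_origin_cost x y : cost p x y <= 4 * (origin_cost x + origin_cost y).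
Proof.
rewrite /cost /origin_cost -big_split/= mulr_sumr; apply: ler_sum => j _.
by rewrite (le_trans (alphaD _ p12 _ _))// alphaN.
Qed.

Lemma origin_cost_le x y : origin_cost x <= 4 * (cost p x y + origin_cost y).
Proof.
rewrite /cost /origin_cost -big_split/= mulr_sumr; apply: ler_sum => j _.
by rewrite -{1}(subrK (tnth y j) (tnth x j)) (le_trans (alphaD _ p12 _ _)).
Qed.

(** The difference [x - y] is [x' - y'] plus an error of at most [2 * delta] per coordinate. The
    quasi-triangle inequality gives the factor 4 and turns the squared error into $4\cdot
    4\delta^2$. *)
Lemma cost_perturb (delta : R) (x x' y y' : T) : 0 <= delta ->
  (forall j, `|tnth x j - tnth x' j| <= delta) ->
  (forall j, `|tnth y j - tnth y' j| <= delta) ->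
  cost p x y <= 4 * cost p x' y' + 16 * d%:R * delta ^+ 2.
Proof.
move=> d0 xx yy.
have -> : 16 * d%:R * delta ^+ 2 = \sum_(j < d) (16 * delta ^+ 2).
  by rewrite sumr_const card_ord -mulr_natr; ring.
rewrite /cost mulr_sumr -big_split/=; apply: ler_sum => j _.
set u := tnth x' j - tnth y' j; set v := (tnth x j - tnth x' j) - (tnth y j - tnth y' j).
have -> : tnth x j - tnth y j = u + v by rewrite /u /v; ring.
apply: (le_trans (alphaD _ p12 _ _)); rewrite mulrDr lerD2l.
apply: (@le_trans _ _ (4 * v ^+ 2)); first by rewrite ler_wpM2l// alpha_le_sqr.
have : `|v| <= 2 * delta.
  by rewrite (le_trans (ler_normB _ _))//; have := xx j; have := yy j; lra.
move=> v2; have : v ^+ 2 <= (2 * delta) ^+ 2.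
  by rewrite -(real_normK (num_real v)) lerXn2r ?nnegrE// mulr_ge0.
by rewrite exprMn; lra.
Qed.

End Radius.

Section Concentration.
Context {R : realType} {d : nat} (mu : probability (d.-tuple R) R) (p a b : R).
Hypotheses (p12 : 1 <= p <= 2) (a0 : 0 < a) (b0 : 0 <= b).
Hypothesis conc : concentration mu p a b.
Local Notation T := (d.-tuple R).

Lemma product1E (P : probability (1.-tuple T) R) (B : set T) :
  is_product mu P -> measurable B -> P [set x | B (tnth x ord0)] = mu B.
Proof.
move=> prP mB.
have -> : [set x : 1.-tuple T | B (tnth x ord0)] = [set x | forall i, B (tnth x i)].
  by apply/seteqP; split => [x /= Bx i|x //=]; rewrite (ord1 i).
by rewrite (prP (fun=> B))// big_ord1.
Qed.

(** Concentration for [n = 1] around a set of mass at least 1/2 on which the origin cost is at most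
    [N]. On its enlargement the origin cost is at most $4(8r+N)$, whence 32 and the choice of
    [c0]. *)
Lemma concentration_origin_cost_tail : exists2 c0, 0 <= c0 &
  forall r : R, 0 <= r ->
    (mu [set x | 32 * r + c0 < origin_cost p x]%R <= (b * expR (- (a * r)))%:E)%E.
Proof.
have mr := @measurable_origin_cost R d p.
have [N] : exists N : nat, (mu [set x | N%:R < origin_cost p x]%R <= (2^-1)%:E)%E.
  have h0 : 0 < 2^-1 :> R by lra.
  by have [N _ HN] := prob_tail mu _ mr _ h0; exists N; exact: HN (leqnn N).
set S := [set x | _] => NS.
have mS : measurable S by exact: measurable_superlevel.
exists (4 * N%:R) => [|r r0]; first by rewrite mulr_ge0.
have [P prP] := product_exists mu 1.
set S' := [set x | _].
have mS' : measurable S' by exact: measurable_superlevel.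
have mC : measurable (~` S') by exact: measurableC.
have mC0 : measurable (~` S) by exact: measurableC.
have mlift (B : set T) : measurable B -> measurable [set x : 1.-tuple T | B (tnth x ord0)].
  by move=> mB; rewrite -[X in measurable X]setTI; exact: measurable_tnth.
have := conc 1 isT P prP [set x | (~` S) (tnth x ord0)] (mlift _ mC0).
rewrite product1E// probability_setC//.
have Sfin : mu S = (fine (mu S))%:E by rewrite fineK// fin_num_measure.
have S'fin : mu S' = (fine (mu S'))%:E by rewrite fineK// fin_num_measure.
move=> /(_ _ r r0)/wrap[|H].
  by move: NS; rewrite Sfin -EFinB !lee_fin => ?; lra.
have : (outer P (enlarge p r [set x : 1.-tuple T | (~` S) (tnth x ord0)]) <=
    P [set x | (~` S') (tnth x ord0)])%E.
  apply: ereal_inf_lbound; exists [set x | (~` S') (tnth x ord0)] => //.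
  split; first exact: mlift.
  move=> x /(enlarge_ncost _ p12 _ _ _ r0)[y Sy].
  rewrite /ncost big_ord1 -/(cost p (tnth x ord0) (tnth y ord0)) => cxy /=.
  apply/negP; rewrite -leNgt.
  have : origin_cost p (tnth y ord0) <= N%:R by rewrite leNgt; apply/negP.
  by have := origin_cost_le p p12 (tnth x ord0) (tnth y ord0); lra.
move=> /(le_trans H); rewrite product1E// probability_setC// S'fin -EFinB !lee_fin.
by lra.
Qed.

Lemma concentration_exp_moment : exists c c0 B : R, [/\ 0 < c, 0 <= c0, 0 < B &
  forall n : nat, (\int[mu]_x (expR (c * Num.min (origin_cost p x) (32 * n%:R + c0)))%:E <= B%:E)%E].
Proof.
have [c0 c00 tail] := concentration_origin_cost_tail.
have s0 : 0 < 32 :> R by lra.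
have [k|B B0 HB] := exp_moment_truncation mu _ (@measurable_origin_cost R d p)
  a b 32 c0 a0 b0 s0 c00 _; first by apply: tail.
by exists (a / (2 * 32)), c0, B; split => //; rewrite divr_gt0// mulr_gt0.
Qed.

Lemma concentration_origin_cost_integrable : mu.-integrable setT (EFin \o origin_cost p).
Proof.
have [c [c0 [B [c_gt0 c00 B0 HB]]]] := concentration_exp_moment.
have s0 : 0 < 32 :> R by lra.
apply: (integrable_truncation mu _ (@measurable_origin_cost R d p) (@origin_cost_ge0 _ _ p)
  (c^-1 * B) c0 32 s0 c00) => n.
have mm : measurable_fun setT (fun x : T => Num.min (origin_cost p x) (32 * n%:R + c0)).
  by apply: measurable_minr; [exact: measurable_origin_cost|exact: measurable_cst].
have me : measurable_fun setT (fun x : T => expR (c * Num.min (origin_cost p x) (32 * n%:R + c0))).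
  by apply: measurableT_comp => //; apply: measurable_funM => //; exact: measurable_cst.
have m0 (x : T) : 0 <= Num.min (origin_cost p x) (32 * n%:R + c0).
  by rewrite le_min origin_cost_ge0 addr_ge0// mulr_ge0.
apply: (@le_trans _ _ (\int[mu]_x ((c^-1)%:E *
    (expR (c * Num.min (origin_cost p x) (32 * n%:R + c0)))%:E))%E).
  apply: ge0_le_integral => //.
  - by move=> x _; rewrite lee_fin.
  - exact/measurable_EFinP.
  - by apply: emeasurable_funM => //; exact/measurable_EFinP.
  - move=> x _; rewrite -EFinM lee_fin -(ler_pM2l c_gt0) mulVKf ?gt_eqF//.
    by apply: le_trans (expR_ge1Dx _); rewrite lerDr.
rewrite ge0_integralZl//; last 2 first.
- exact/measurable_EFinP.
- by rewrite lee_fin invr_ge0 ltW.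
by rewrite EFinM lee_wpmul2l// lee_fin invr_ge0 ltW.
Qed.

(** [entropy_ge], applied to [c] times a truncated origin cost, bounds the [nu]-integral of every
    truncation by $(H+\ln B)/c$. *)
Lemma entropy_origin_cost_integrable (nu : probability T R) :
  (entropy nu mu < +oo)%E -> nu.-integrable setT (EFin \o origin_cost p).
Proof.
have [c [c0 [B [c_gt0 c00 B0 HB]]]] := concentration_exp_moment.
have s0 : 0 < 32 :> R by lra.
move=> entoo; have := entropy_ge0 nu mu; case entE : (entropy nu mu) entoo => [H| |]// _ _.
apply: (integrable_truncation nu _ (@measurable_origin_cost R d p) (@origin_cost_ge0 _ _ p)
  (c^-1 * (H + ln B)) c0 32 s0 c00) => n.
have mm : measurable_fun setT (fun x : T => Num.min (origin_cost p x) (32 * n%:R + c0)).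
  by apply: measurable_minr; [exact: measurable_origin_cost|exact: measurable_cst].
have M0 : 0 <= 32 * n%:R + c0 by rewrite addr_ge0// mulr_ge0.
have m0 (x : T) : 0 <= Num.min (origin_cost p x) (32 * n%:R + c0) <= 32 * n%:R + c0.
  by rewrite le_min origin_cost_ge0 M0 ge_min lexx orbT.
have [I _ IE] := integral_fin nu _ _ mm m0.
rewrite IE lee_fin.
have DV : c * I - ln B <= H.
  rewrite -lee_fin -entE.
  apply: (@entropy_ge R d nu mu (fun x => c * Num.min (origin_cost p x) (32 * n%:R + c0))
    (c * (32 * n%:R + c0)) B (c * I)) => //.
  - by apply: measurable_funM => //; exact: measurable_cst.
  - move=> x; have /andP[h1 h2] := m0 x.
    by rewrite ger0_norm ?mulr_ge0 ?(ltW c_gt0)// ler_wpM2l// ltW.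
  - under eq_integral do rewrite EFinM.
    rewrite ge0_integralZl//; first by rewrite IE EFinM.
    + exact/measurable_EFinP.
    + by move=> x _; rewrite lee_fin; case/andP: (m0 x).
    + by rewrite lee_fin ltW.
by rewrite -(ler_pM2l c_gt0) mulVKf ?gt_eqF//; lra.
Qed.

End Concentration.

(** * Matched typical samples *)

Section MatchedSamples.
Context {R : realType} {d : nat} (nu mu : probability (d.-tuple R) R).
Local Notation T := (d.-tuple R).
Context {K : finType} (q : T -> K).
Hypothesis mq : forall k, measurable (q @^-1` [set k]).
Local Notation pk := (cell_mass q nu).
Local Notation qk := (cell_mass q mu).

Lemma cell_mass_dominates k : nu `<< mu -> qk k = 0 -> pk k = 0.
Proof.
move=> /null_content_dominatesP nm qk0.
have : nu (q @^-1` [set k]) = 0%E by apply: nm => //; apply: (etrans (cell_massE q mq mu k)); rewrite qk0.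
by rewrite cell_massE// => -[].
Qed.

(* Log-likelihood ratio of the quantized laws; the finite value [- L] on
   [nu]-null cells keeps it bounded. *)
Definition log_ratio (L : R) (k : K) : R :=
  if pk k == 0 then - L else ln (pk k / qk k).

(** Quantization does not increase entropy: [entropy_ge] is applied to the log-ratio composed with
    [q]. The default [- L] contributes at most $e^{-L}$ to the exponential integral, and
    $\ln(1+e^{-L})\le e^{-L}$. *)
Lemma log_ratio_entropy (H L : R) : entropy nu mu = H%:E ->
  \sum_k pk k * log_ratio L k <= H + expR (- L).
Proof.
move=> entH.
have nm : nu `<< mu by move: entH; rewrite /entropy; case: asboolP.
have p0 := cell_mass_ge0 q nu; have q0 := cell_mass_ge0 q mu.
have p1 := sum_cell_mass q mq nu; have q1 := sum_cell_mass q mq mu.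
pose psi := log_ratio L; pose M := \sum_k `|psi k|.
have psiM k : `|psi k| <= M by rewrite /M (bigD1 k)//= lerDl sumr_ge0.
have mpsi : measurable_fun setT (psi \o q) by exact: measurable_quantized.
have Z0 : 0 < 1 + expR (- L) by rewrite ltr_pwDl ?expR_ge0.
have inu : (\int[nu]_x (psi (q x))%:E = (\sum_k pk k * psi k)%:E)%E.
  have psi'0 k : 0 <= psi k + M by have := psiM k; rewrite ler_norml => /andP[]; lra.
  have E := integral_quantized q mq nu (fun k => psi k + M) psi'0.
  transitivity (\int[nu]_x ((psi (q x) + M)%:E - (cst M x)%:E))%E.
    by apply: eq_integral => x _; rewrite -EFinB addrK.
  rewrite integralB//; last 2 first.
  - apply: (@bounded_integrable _ _ _ nu (fun x => psi (q x) + M) (M + M)).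
      by apply: measurable_funD => //; exact: measurable_cst.
    by move=> x; rewrite (le_trans (ler_normD _ _))// lerD// ger0_norm// (le_trans (normr_ge0 (psi (q x)))).
  - exact: finite_measure_integrable_cst.
  rewrite E -[X in (_ - X)%E]/(\int[nu]_x (cst M%:E x))%E (integral_cst _ measurableT).
  rewrite /= probability_setT mule1 -EFinB.
  congr (_%:E); under eq_bigr do rewrite mulrDl.
  rewrite big_split/= -mulr_sumr p1 mulr1 addrK.
  by apply: eq_bigr => k _; rewrite mulrC.
have DV : \sum_k pk k * psi k - ln (1 + expR (- L)) <= H.
  rewrite -lee_fin -entH.
  apply: (@entropy_ge R d nu mu (psi \o q) M) => //; first by move=> x; exact: psiM.
  rewrite (integral_quantized q mq mu (fun k => expR (psi k)))//.
  rewrite lee_fin.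
  apply: (@le_trans _ _ (\sum_k (pk k + expR (- L) * qk k))).
    apply: ler_sum => k _; rewrite /psi /log_ratio; case: ifPn => [/eqP ->|pn].
      by rewrite add0r.
    have qn : qk k != 0 by apply: contra_neq pn; exact: cell_mass_dominates.
    rewrite lnK ?posrE ?divr_gt0 ?lt_neqAle ?p0 ?q0 ?andbT 1?eq_sym//.
    by rewrite divfK// lerDl mulr_ge0 ?expR_ge0.
  by rewrite big_split/= -mulr_sumr p1 q1 mulr1.
have : ln (1 + expR (- L)) <= expR (- L).
  by rewrite -[leRHS]expRK ler_ln ?posrE ?expR_gt0// expR_ge1Dx.
by lra.
Qed.

Variables (p a b : R).
Hypotheses (p12 : 1 <= p <= 2) (a0 : 0 < a) (b0 : 0 <= b).
Hypothesis conc : concentration mu p a b.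

(** With $r=n(H+3\eta)/a$ the concentration defect $be^{-ar}$ is smaller than the lower bound
    $e^{-n(H+2\eta)}/2$ for the mass of [B], so the enlargement of [A] must meet [B]. One [eta] is
    the error of the quantized entropy, one the typicality margin, and the third absorbs [b] and the
    factor 1/2. *)
Lemma matched_samples (H eta : R) : entropy nu mu = H%:E -> 0 < eta ->
  exists n (x y : n.-tuple T), [/\ (0 < n)%N,
    ncost p x y <= n%:R * (8 * (H + 3 * eta) / a),
    forall k, \sum_(i < n) (q (tnth x i) == k)%:R <= n%:R * ((1 + eta) * pk k) &
    forall k, \sum_(i < n) (q (tnth y i) == k)%:R <= n%:R * ((1 + eta) * qk k)].
Proof.
move=> entH eta0.
have H0 : 0 <= H by have := entropy_ge0 nu mu; rewrite entH lee_fin.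
have nm : nu `<< mu by move: entH; rewrite /entropy; case: asboolP.
have p0 := cell_mass_ge0 q nu; have q0 := cell_mass_ge0 q mu.
have p1 := sum_cell_mass q mq nu; have q1 := sum_cell_mass q mq mu.
pose L := - ln eta.
have eL : expR (- L) = eta by rewrite /L opprK lnK.
have HL := log_ratio_entropy H L entH; rewrite eL in HL.
(* Dividing the indicator by the cell mass gives it mean 1, so the additive margin [eta] becomes a
   relative error on the frequency. Null cells are excluded by requiring nonzero weight of the whole
   sample. *)
pose freq (w : K -> R) (k k' : K) : R := (k' == k)%:R / w k.
have freqE (w : K -> R) k : \sum_k' w k' * freq w k k' = (w k != 0)%:R.
  rewrite (bigD1 k)//= /freq eqxx mul1r big1 ?addr0.
    by have [->|wn] := eqVneq (w k) 0; rewrite ?mul0r// divff.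
  by move=> k' /negPf ->; rewrite mul0r mulr0.
have freq_count (w : K -> R) n (s : {ffun 'I_n -> K}) k : (forall k, 0 <= w k) ->
    wprod w n s != 0 ->
    \sum_(i < n) freq w k (s i) <= n%:R * (\sum_k' w k' * freq w k k' + eta) ->
    \sum_(i < n) (s i == k)%:R <= n%:R * ((1 + eta) * w k).
  move=> w0 ws; rewrite freqE /freq -mulr_suml.
  have [wk|wk] := eqVneq (w k) 0.
    move=> _; rewrite wk !mulr0 big1// => i _.
    case: eqP => // sik; move: ws; rewrite /wprod (bigD1 i)//= sik wk mul0r.
    by rewrite eqxx.
  by rewrite ler_pdivrMr ?lt_neqAle ?w0 1?eq_sym ?wk//= -mulrA.
(* The slot [None] carries the log-likelihood ratio, so one typicality event controls it together
   with all frequencies. *)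
pose gnu (o : option K) := if o is Some k then freq pk k else log_ratio L.
have [N1 _ HN1] := typical_half pk p0 p1 gnu eta eta0.
have [N2 _ HN2] := typical_half qk q0 q1 (freq qk) eta eta0.
have [N3 bN3] : exists N3 : nat, forall n, (N3 <= n)%N -> b * expR (- (n%:R * eta)) < 2^-1.
  exists (Num.truncn (2 * b / eta)).+1 => n nN.
  have nb : 2 * b < n%:R * eta.
    rewrite -ltr_pdivrMr//; apply: (lt_le_trans (truncnS_gt _)).
    by rewrite ler_nat.
  rewrite expRN -ltr_pdivlMr ?invr_gt0 ?expR_gt0// invrK.
  have := expR_ge1Dx (n%:R * eta); lra.
pose n := (maxn 1 (maxn N1 (maxn N2 N3)))%N.
have n_gt0 : (0 < n)%N by rewrite leq_max.
have [P prP] := product_exists mu n.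
pose Sx := [pred s : {ffun 'I_n -> K} | (s \in typical pk gnu eta n) && (wprod pk n s != 0)].
pose Sy := [pred s : {ffun 'I_n -> K} | (s \in typical qk (freq qk) eta n) && (wprod qk n s != 0)].
have nz (w : K -> R) (S : pred {ffun 'I_n -> K}) :
    \sum_(s in S) wprod w n s = \sum_(s | (s \in S) && (wprod w n s != 0)) wprod w n s.
  rewrite big_mkcondr/=; apply: eq_bigr => s _.
  by case: eqVneq => // ->.
have mqn := measurable_quantize q mq n.
pose A := [set y : n.-tuple T | Sy (quantize q n y)].
pose B := [set x : n.-tuple T | Sx (quantize q n x)].
have mA : measurable A by exact: measurable_quantized_set.
have mB : measurable B by exact: measurable_quantized_set.
have PA : ((1 / 2)%:E <= P A)%E.
  rewrite (prob_quantized (quantize q n) mqn) lee_fin.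
  under eq_bigr do rewrite (cell_mass_quantize q mq n mu)//.
  by rewrite -nz mul1r; apply: HN2; rewrite /n /= !leq_max leqnn !orbT.
have n1 : (N1 <= n)%N by rewrite /n !leq_max leqnn !orbT.
(* Change of measure: on [Sx] the [nu]-weight is the [mu]-weight times the exponential of the summed
   log-ratios, and typicality bounds that sum by $n(H+2\eta)$. *)
have PB : ((expR (- (n%:R * (H + 2 * eta))) / 2)%:E <= P B)%E.
  rewrite (prob_quantized (quantize q n) mqn) lee_fin.
  under eq_bigr do rewrite (cell_mass_quantize q mq n mu)//.
  apply: (@le_trans _ _ (\sum_(s | Sx s) expR (- (n%:R * (H + 2 * eta))) * wprod pk n s)).
    by rewrite -mulr_sumr ler_wpM2l ?expR_ge0// -nz; exact: HN1.
  apply: ler_sum => s /andP[/forallP typ ws].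
  have psn i : pk (s i) != 0.
    by move: ws; rewrite /wprod prodf_seq_neq0 => /allP/(_ i (mem_index_enum _)).
  have qsn i : qk (s i) != 0.
    by apply: contra_neq (psn i); exact: cell_mass_dominates.
  have psp i : 0 < pk (s i) by rewrite lt_neqAle eq_sym psn p0.
  have qsp i : 0 < qk (s i) by rewrite lt_neqAle eq_sym qsn q0.
  have -> : wprod pk n s = expR (\sum_(i < n) log_ratio L (s i)) * wprod qk n s.
    rewrite expR_sum /wprod -big_split/=; apply: eq_bigr => i _.
    by rewrite /log_ratio (negPf (psn i)) lnK ?posrE ?divr_gt0// divfK.
  rewrite mulrA -expRD -[leRHS]mul1r ler_wpM2r ?wprod_ge0//.
  rewrite -[leRHS]expR0 ler_expR addrC subr_le0.
  by apply: le_trans (typ None) _; rewrite ler_wpM2l// /gnu; lra.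
pose r := n%:R * (H + 3 * eta) / a.
have r0 : 0 <= r by rewrite divr_ge0 ?(ltW a0)// mulr_ge0//; lra.
have [[x [Bx Ax]]|noB] := pselect (exists x, B x /\ enlarge p r A x).
  have [y Ay xy] := enlarge_ncost _ p12 _ _ _ r0 Ax.
  move: Bx => /= /andP[/forallP xtyp xw]; move: Ay => /= /andP[/forallP ytyp yw].
  exists n, x, y; split => //.
  - have -> : n%:R * (8 * (H + 3 * eta) / a) = 8 * r by rewrite /r; field; rewrite gt_eqF.
    exact: xy.
  - move=> k; have := freq_count pk n (quantize q n x) k p0 xw (xtyp (Some k)).
    by apply: le_trans; apply: ler_sum => i _; rewrite ffunE.
  - move=> k; have := freq_count qk n (quantize q n y) k q0 yw (ytyp k).
    by apply: le_trans; apply: ler_sum => i _; rewrite ffunE.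
have mCB : measurable (~` B) by exact: measurableC.
have := conc n n_gt0 P prP A mA PA r r0.
(* If the sets were disjoint, the measurable complement of [B] would bound the outer measure,
   against the choice of [r] and [n]. *)
have : (outer P (enlarge p r A) <= P (~` B))%E.
  apply: ereal_inf_lbound; exists (~` B) => //; split => // x Ax Bx.
  by apply: noB; exists x.
have PBfin : P B = (fine (P B))%:E by rewrite fineK// fin_num_measure.
move=> /[swap] /le_trans/[apply]; rewrite probability_setC//.
move: PB; rewrite PBfin -EFinB !lee_fin => PB PBb.
have ar : a * r = n%:R * (H + 2 * eta) + n%:R * eta.
  by rewrite /r; field; rewrite gt_eqF.
have : b * expR (- (n%:R * eta)) < 2^-1 by apply: bN3; rewrite /n !leq_max leqnn !orbT.
have e0 := expR_gt0 (- (n%:R * (H + 2 * eta))).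
rewrite -(ltr_pM2l e0) mulrCA -expRD -opprD -ar; lra.
Qed.

End MatchedSamples.

(** * Gluing the empirical coupling *)

(** A cell is the truth table of the tests whether coordinate [j] lies in interval [i], so there are
    finitely many cells, all measurable. The intervals have length [delta] and cover [[-M, M)]; a
    cell is good if every coordinate hits one of them. *)
Lemma quantization {R : realType} {d : nat} (nu mu : probability (d.-tuple R) R)
    (delta e : R) : 0 < delta -> 0 < e ->
  exists (K : finType) (q : d.-tuple R -> K) (good : pred K),
  [/\ forall k, measurable (q @^-1` [set k]),
      forall x x', good (q x) -> q x = q x' -> forall j, `|tnth x j - tnth x' j| <= delta,
      \sum_(k | ~~ good k) cell_mass q nu k <= e &
      \sum_(k | ~~ good k) cell_mass q mu k <= e].
Proof.
move=> d0 e0; pose h (x : d.-tuple R) : R := \sum_(j < d) `|tnth x j|.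
have mtn (j : 'I_d) : measurable_fun setT (fun x : d.-tuple R => tnth x j).
  exact: measurable_tnth.
have mh : measurable_fun setT h.
  by apply: measurable_sum => j; exact: measurableT_comp.
have [N1 _ HN1] := prob_tail nu _ mh _ e0.
have [N2 _ HN2] := prob_tail mu _ mh _ e0.
(* The successor gives $|x_j|<M$ strictly as soon as [h x <= N0]. *)
pose N0 := maxn N1 N2; pose M : R := N0.+1%:R.
pose N := (Num.truncn (2 * M / delta)).+1.
have NM : 2 * M < N%:R * delta.
  by rewrite -ltr_pdivrMr//; exact: truncnS_gt.
pose b (x : d.-tuple R) (ji : 'I_d * 'I_N) :=
  (- M + ji.2%:R * delta <= tnth x ji.1) && (tnth x ji.1 < - M + ji.2.+1%:R * delta).
pose K : finType := {ffun 'I_d * 'I_N -> bool}.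
pose q x : K := [ffun ji => b x ji].
pose good : pred K := fun k => [forall j, [exists i, k (j, i)]].
have mq k : measurable (q @^-1` [set k]).
  rewrite (_ : _ @^-1` _ = \big[setI/setT]_(ji : 'I_d * 'I_N) ((b ^~ ji) @^-1` [set k ji])).
    apply: bigsetI_measurable => ji _.
    have mb : measurable_fun setT (b ^~ ji).
      by apply: measurable_and; [exact: measurable_fun_ler|exact: measurable_fun_ltr].
    by rewrite -[X in measurable X]setTI; exact: mb.
  rewrite -bigcap_seq; apply/seteqP; split => [x /= <- ji _ /=|x /= H].
    by rewrite ffunE.
  by apply/ffunP => ji; rewrite ffunE; apply: H; rewrite /= mem_index_enum.
have bad x : ~~ good (q x) -> N0%:R < h x.
  rewrite /good negb_forall => /existsP[j]; rewrite negb_exists => /forallP H.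
  rewrite ltNge; apply/negP => hN.
  have : `|tnth x j| < M.
    apply: (@le_lt_trans _ _ (h x)); first by rewrite /h (bigD1 j)//= lerDl sumr_ge0.
    by rewrite (le_lt_trans hN)// ltr_nat.
  rewrite ltr_norml => /andP[x1 x2].
  have t0 : 0 <= (tnth x j + M) / delta by rewrite divr_ge0 ?(ltW d0)//; lra.
  have tN : (Num.truncn ((tnth x j + M) / delta) < N)%N.
    by rewrite truncn_lt_nat// ltr_pdivrMr//; lra.
  have := H (Ordinal tN); rewrite ffunE /b /= => /negP; apply.
  have /andP[t1 t2] := truncn_itv t0.
  move: t1 t2; rewrite ler_pdivlMr// ltr_pdivrMr// => t1 t2.
  by apply/andP; split; lra.
have mass (P : probability (d.-tuple R) R) :
    (P [set x | N0%:R < h x]%R <= e%:E)%E -> \sum_(k | ~~ good k) cell_mass q P k <= e.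
  move=> PN; rewrite -lee_fin -(prob_quantized q mq P (fun k => ~~ good k)).
  apply: le_trans PN; apply: le_measure; rewrite ?inE.
  - exact: (measurable_quantized_set q mq (fun k => ~~ good k)).
  - exact: measurable_superlevel.
  - by move=> x /= /bad.
exists K, q, good; split => //.
- move=> x x' /forallP gx qq j; have /existsP[i] := gx j.
  move=> gi; have gi' := gi; rewrite {1}ffunE in gi; rewrite qq ffunE in gi'.
  move: gi gi'; rewrite /b /= -natr1 => /andP[g1 g2] /andP[g3 g4].
  by rewrite ler_norml; apply/andP; split; lra.
- by apply: mass; apply: HN1; rewrite /N0 /= leq_maxl.
- by apply: mass; apply: HN2; rewrite /N0 /= leq_maxr.
Qed.

Lemma integral_product_mul {d1 d2} {T1 : measurableType d1} {T2 : measurableType d2}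
    {R : realType} (P1 : probability T1 R) (P2 : probability T2 R)
    (f1 : T1 -> \bar R) (f2 : T2 -> \bar R) :
  measurable_fun setT f1 -> measurable_fun setT f2 ->
  (forall x, 0 <= f1 x)%E -> (forall x, 0 <= f2 x)%E ->
  (\int[P1 \x P2]_z (f1 z.1 * f2 z.2) = \int[P1]_x f1 x * \int[P2]_y f2 y)%E.
Proof.
move=> m1 m2 f10 f20.
rewrite fubini_tonelli1//; last 2 first.
- apply: emeasurable_funM.
  + exact: (measurableT_comp m1 measurable_fst).
  + exact: (measurableT_comp m2 measurable_snd).
- by move=> z; rewrite mule_ge0.
rewrite -ge0_integralZr//; last by apply: integral_ge0 => y _.
by apply: eq_integral => x _; rewrite /fubini_F /= ge0_integralZl.
Qed.

Section Gluing.
Context {R : realType} {d : nat} (nu mu : probability (d.-tuple R) R).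
Local Notation T := (d.-tuple R).
Context {K : finType} (q : T -> K).
Hypothesis mq : forall k, measurable (q @^-1` [set k]).
Local Notation pk := (cell_mass q nu).
Local Notation qk := (cell_mass q mu).

Let q2 (z : T * T) := (q z.1, q z.2).

Let q2E kl : q2 @^-1` [set kl] = (q @^-1` [set kl.1]) `*` (q @^-1` [set kl.2]).
Proof.
case: kl => k l; apply/seteqP; split => [z /= [<- <-]//|[z1 z2] /= [<- <-]//].
Qed.

Let mq2 kl : measurable (q2 @^-1` [set kl]).
Proof. by rewrite q2E; exact: measurableX. Qed.

Let q2_mass kl : cell_mass q2 (nu \x mu)%E kl = pk kl.1 * qk kl.2.
Proof.
rewrite /cell_mass q2E -fineM ?fin_num_measure//; congr fine.
exact: product_measure1E.
Qed.

Lemma measurable_quantized_pair (D : K -> K -> R) :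
  measurable_fun setT (fun z : T * T => D (q z.1) (q z.2)).
Proof. exact: (measurable_quantized q2 mq2 (fun kl => D kl.1 kl.2)). Qed.

Lemma integral_quantized_pair (D : K -> K -> R) : (forall k l, 0 <= D k l) ->
  (\int[nu \x mu]_z (D (q z.1) (q z.2))%:E =
   (\sum_k \sum_l D k l * (pk k * qk l))%:E)%E.
Proof.
move=> D0.
rewrite (integral_quantized q2 mq2 (nu \x mu)%E (fun kl => D kl.1 kl.2))//.
rewrite pair_big/=; congr (_%:E); apply: eq_bigr => -[k l] _ /=; congr (_ * _).
by rewrite q2_mass.
Qed.

(** The coupling has density [D] of the cells relative to the product law: only the mass exchanged
    between cells is prescribed. By Tonelli the inner integrals are the row and column sums of [D],
    which gives the marginals. *)
Lemma balanced_coupling (D : K -> K -> R) : (forall k l, 0 <= D k l) ->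
  (forall k, \sum_l D k l * qk l = 1) -> (forall l, \sum_k D k l * pk k = 1) ->
  exists2 pi : probability (T * T)%type R, coupling nu mu pi &
    forall c : T * T -> R, measurable_fun setT c -> (forall z, 0 <= c z) ->
    (\int[pi]_z (c z)%:E = \int[nu \x mu]_z (c z * D (q z.1) (q z.2))%:E)%E.
Proof.
move=> D0 Drow Dcol.
pose f z := D (q z.1) (q z.2).
have mf : measurable_fun setT f by exact: measurable_quantized_pair.
have f0 z : 0 <= f z by exact: D0.
have f1 : (\int[nu \x mu]_z (f z)%:E = 1)%E.
  rewrite integral_quantized_pair//.
  under eq_bigr do under eq_bigr do rewrite mulrCA mulrC.
  under eq_bigr do rewrite -mulr_suml Drow mul1r.
  by rewrite sum_cell_mass.
pose pi : probability (T * T)%type R := density (nu \x mu)%E f mf f0 f1.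
have piE (c : T * T -> R) : measurable_fun setT c -> (forall z, 0 <= c z) ->
    (\int[pi]_z (c z)%:E = \int[nu \x mu]_z (c z * f z)%:E)%E.
  move=> mc c0; rewrite integral_density//; first exact/measurable_EFinP.
have ind_ge0 (S : set T) x : 0 <= \1_S x :> R by rewrite indicE.
have mi1 (A : set T) : measurable A -> measurable_fun setT (fun z : T * T => \1_A z.1 : R).
  move=> mA; have mi : measurable_fun setT (\1_A : T -> R) by exact: measurable_indic.
  exact: (measurableT_comp mi measurable_fst).
have mi2 (A : set T) : measurable A -> measurable_fun setT (fun z : T * T => \1_A z.2 : R).
  move=> mA; have mi : measurable_fun setT (\1_A : T -> R) by exact: measurable_indic.
  exact: (measurableT_comp mi measurable_snd).
exists pi => //; split => A mA.
  have mS : measurable (A `*` @setT T) by exact: measurableX.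
  transitivity (\int[pi]_z ((\1_A z.1)%:E))%E.
    rewrite -(setIT (A `*` setT)) -integral_indic//.
    by apply: eq_integral => z _; rewrite !indicE in_setX in_setT andbT.
  rewrite piE//; last first.
    exact: mi1.
  rewrite fubini_tonelli1//; last 2 first.
  - apply/measurable_EFinP; apply: measurable_funM => //.
    exact: mi1.
  - by move=> z; rewrite lee_fin mulr_ge0.
  transitivity (\int[nu]_x (\1_A x)%:E)%E; last by rewrite integral_indic// setIT.
  apply: eq_integral => x _; rewrite /fubini_F /f /=.
  rewrite (integral_quantized q mq mu (fun l => \1_A x * D (q x) l)).
    under eq_bigr do rewrite -mulrA.
    by rewrite -mulr_sumr Drow mulr1.
  by move=> l; rewrite mulr_ge0.
have mS : measurable (@setT T `*` A) by exact: measurableX.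
transitivity (\int[pi]_z ((\1_A z.2)%:E))%E.
  rewrite -(setIT (setT `*` A)) -integral_indic//.
  by apply: eq_integral => z _; rewrite !indicE in_setX in_setT.
rewrite piE//; last first.
  exact: mi2.
rewrite fubini_tonelli2//; last 2 first.
- apply/measurable_EFinP; apply: measurable_funM => //.
  exact: mi2.
- by move=> z; rewrite lee_fin mulr_ge0.
transitivity (\int[mu]_x (\1_A x)%:E)%E; last by rewrite integral_indic// setIT.
apply: eq_integral => y _; rewrite /fubini_G /f /=.
rewrite (integral_quantized q mq nu (fun k => \1_A y * D k (q y))).
  under eq_bigr do rewrite -mulrA.
  by rewrite -mulr_sumr Dcol mulr1.
by move=> l; rewrite mulr_ge0.
Qed.

Lemma measurable_null_cells :
  measurable [set z : T * T | (pk (q z.1) == 0) || (qk (q z.2) == 0)].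
Proof.
exact: (measurable_quantized_set q2 mq2 (fun kl => (pk kl.1 == 0) || (qk kl.2 == 0))).
Qed.

Lemma product_null_cells :
  (nu \x mu)%E [set z | (pk (q z.1) == 0) || (qk (q z.2) == 0)] = 0%E.
Proof.
have := prob_quantized q2 mq2 (nu \x mu)%E (fun kl => (pk kl.1 == 0) || (qk kl.2 == 0)).
move=> ->; congr (_%:E); apply: big1 => -[k l] /= kl.
by rewrite q2_mass /=; case/orP: kl => /eqP ->; rewrite ?mul0r ?mulr0.
Qed.

End Gluing.

Section JointCounts.
Context {R : realType} {K : finType} {n : nat} (u v : 'I_n -> K).

(** For [f] equal to 1 this is the contingency table of the two quantized samples; for [f] a cost,
    it collects the cost of the sample pairs by pair of cells. *)
Definition joint_sum (f : 'I_n -> R) (k l : K) : R :=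
  \sum_(i < n) ((u i == k) && (v i == l))%:R * f i.

Lemma joint_sum_ge0 f k l : (forall i, 0 <= f i) -> 0 <= joint_sum f k l.
Proof. by move=> f0; apply: sumr_ge0 => i _; rewrite mulr_ge0. Qed.

Lemma joint_sum_total (f : 'I_n -> R) (g : K -> K -> R) :
  \sum_k \sum_l g k l * joint_sum f k l = \sum_(i < n) g (u i) (v i) * f i.
Proof.
rewrite pair_big/=.
under eq_bigr do rewrite mulr_sumr.
rewrite exchange_big/=; apply: eq_bigr => i _.
rewrite (bigD1 (u i, v i))//= !eqxx mul1r big1 ?addr0// => -[k l] /= kl.
suff -> : (u i == k) && (v i == l) = false by rewrite mul0r mulr0.
by apply: contraNF kl => /andP[/eqP -> /eqP ->].
Qed.

Lemma joint_sum_row k : \sum_l joint_sum (fun=> 1) k l = \sum_(i < n) (u i == k)%:R.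
Proof.
rewrite exchange_big/=; apply: eq_bigr => i _.
rewrite (bigD1 (v i))//= eqxx andbT mulr1 big1 ?addr0// => l lv.
by rewrite [v i == l]eq_sym (negPf lv) andbF mul0r.
Qed.

Lemma joint_sum_col l : \sum_k joint_sum (fun=> 1) k l = \sum_(i < n) (v i == l)%:R.
Proof.
rewrite exchange_big/=; apply: eq_bigr => i _.
rewrite (bigD1 (u i))//= eqxx mulr1 big1 ?addr0// => k ku.
by rewrite [u i == k]eq_sym (negPf ku) mul0r.
Qed.

Lemma sum_count (S : pred K) (w : 'I_n -> K) :
  \sum_(k | S k) \sum_(i < n) (w i == k)%:R = \sum_(i < n) (S (w i))%:R :> R.
Proof.
rewrite exchange_big/=; apply: eq_bigr => i _.
rewrite big_mkcond/= (bigD1 (w i))//= eqxx big1 ?addr0; first by case: (S _).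
by move=> k kw; case: ifP => // _; rewrite eq_sym (negPf kw).
Qed.

End JointCounts.

Section GluedCost.
Context {R : realType} {d : nat} (nu mu : probability (d.-tuple R) R) (p : R).
Hypothesis p12 : 1 <= p <= 2.
Local Notation T := (d.-tuple R).
Context {K : finType} (q : T -> K) (good : pred K).
Hypothesis mq : forall k, measurable (q @^-1` [set k]).
Local Notation pk := (cell_mass q nu).
Local Notation qk := (cell_mass q mu).
Variables (delta eta t e1 e2 s1 s2 : R).
Hypotheses (delta0 : 0 <= delta) (eta0 : 0 < eta) (t0 : 0 <= t).
Hypothesis close : forall x x', good (q x) -> q x = q x' ->
  forall j, `|tnth x j - tnth x' j| <= delta.
Hypotheses (bad1 : \sum_(k | ~~ good k) pk k <= s1) (bad2 : \sum_(k | ~~ good k) qk k <= s2).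
Let rt (x : T) : R := origin_cost p x * (t < origin_cost p x)%R%:R.
Hypotheses (tail1 : (\int[nu]_x (rt x)%:E <= e1%:E)%E) (tail2 : (\int[mu]_x (rt x)%:E <= e2%:E)%E).
Context {n : nat} (x y : n.-tuple T).
Hypothesis n0 : (0 < n)%N.
Hypothesis count1 : forall k, \sum_(i < n) (q (tnth x i) == k)%:R <= n%:R * ((1 + eta) * pk k).
Hypothesis count2 : forall k, \sum_(i < n) (q (tnth y i) == k)%:R <= n%:R * ((1 + eta) * qk k).

(** Normalization by [1 + eta] besides [n]: it absorbs the relative excess allowed by [count1] and
    [count2]. *)
Let a := (n%:R * (1 + eta))^-1.
Let N := joint_sum (fun i => q (tnth x i)) (fun i => q (tnth y i)) (fun=> 1 : R).
Let S := joint_sum (fun i => q (tnth x i)) (fun i => q (tnth y i))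
  (fun i => 4 * cost p (tnth x i) (tnth y i) + 16 * d%:R * delta ^+ 2).
(** Empirical coupling restricted to good cells, the only ones of small diameter. *)
Let w k l : R := (good k && good l)%:R * N k l * a.

Let nR : 0 < n%:R :> R. Proof. by rewrite ltr0n. Qed.
Let na0 : 0 < n%:R * (1 + eta).
Proof. by apply: mulr_gt0; [exact: nR|have := eta0; lra]. Qed.
Let a0 : 0 < a. Proof. by rewrite invr_gt0 na0. Qed.
Let p0 := cell_mass_ge0 q nu.
Let q0 := cell_mass_ge0 q mu.
Let p1 := sum_cell_mass q mq nu.
Let q1 := sum_cell_mass q mq mu.

Let N0 k l : 0 <= N k l. Proof. by apply: joint_sum_ge0. Qed.

Let S_term_ge0 i : 0 <= 4 * cost p (tnth x i) (tnth y i) + 16 * d%:R * delta ^+ 2.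
Proof. by rewrite addr_ge0 ?mulr_ge0 ?cost_ge0 ?sqr_ge0. Qed.

Let S0 k l : 0 <= S k l. Proof. exact: (joint_sum_ge0 _ _ _ _ _ S_term_ge0). Qed.

Let w0 k l : 0 <= w k l.
Proof. by rewrite /w !mulr_ge0 ?N0 ?(ltW a0). Qed.

Let w_le k l : w k l <= N k l * a.
Proof.
rewrite /w -mulrA; case: (_ && _); rewrite ?mul1r// mul0r.
by rewrite mulr_ge0 ?N0 ?(ltW a0).
Qed.

Let w_row k : \sum_l w k l <= pk k.
Proof.
apply: (@le_trans _ _ (\sum_l N k l * a)); first by apply: ler_sum => l _; exact: w_le.
rewrite -mulr_suml joint_sum_row ler_pdivrMr// (le_trans (count1 k))//.
by rewrite mulrA mulrC.
Qed.

Let w_col l : \sum_k w k l <= qk l.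
Proof.
apply: (@le_trans _ _ (\sum_k N k l * a)); first by apply: ler_sum => k _; exact: w_le.
rewrite -mulr_suml joint_sum_col ler_pdivrMr// (le_trans (count2 l))//.
by rewrite mulrA mulrC.
Qed.

(** The normalization loses at most [eta], since $1/(1+\eta)\ge 1-\eta$. By the count bounds, sample
    pairs with a bad cell account for at most [s1 + s2] after normalization. *)
Let mass_defect : 1 - \sum_k \sum_l w k l <= eta + s1 + s2.
Proof.
have -> : \sum_k \sum_l w k l =
    a * \sum_(i < n) (good (q (tnth x i)) && good (q (tnth y i)))%:R.
  have := joint_sum_total (fun i => q (tnth x i)) (fun i => q (tnth y i))
    (fun=> 1 : R) (fun k l => a * (good k && good l)%:R).
  under [RHS]eq_bigr do rewrite mulr1.
  rewrite -mulr_sumr => <-.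
  by apply: eq_bigr => k _; apply: eq_bigr => l _; rewrite /w mulrC mulrA.
have cnt (z : n.-tuple T) (pr : K -> R) (s : R) :
    (forall k, \sum_(i < n) (q (tnth z i) == k)%:R <= n%:R * ((1 + eta) * pr k)) ->
    \sum_(k | ~~ good k) pr k <= s ->
    \sum_(i < n) (~~ good (q (tnth z i)))%:R <= n%:R * (1 + eta) * s.
  move=> cz bz; rewrite -(sum_count (fun k => ~~ good k) (fun i => q (tnth z i))).
  apply: (@le_trans _ _ (\sum_(k | ~~ good k) n%:R * (1 + eta) * pr k)).
    by apply: ler_sum => k _; rewrite -mulrA; exact: cz.
  by rewrite -mulr_sumr ler_wpM2l// ltW.
have := cnt x _ _ count1 bad1; have := cnt y _ _ count2 bad2.
set bx := \sum_(i < n) (~~ good (q (tnth x i)))%:R.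
set by_ := \sum_(i < n) (~~ good (q (tnth y i)))%:R.
move=> hy hx.
have : n%:R - bx - by_ <= \sum_(i < n) (good (q (tnth x i)) && good (q (tnth y i)))%:R.
  rewrite /bx /by_ -{1}(card_ord n) -[#|'I_n|%:R]sumr_const -!sumrB.
  apply: ler_sum => i _.
  by case: (good _); case: (good _) => /=; lra.
set gs := \sum_(i < n) _ => hgs.
have : 1 - eta - s1 - s2 <= a * gs.
  rewrite mulrC ler_pdivlMr// mulrC.
  have : n%:R * (1 + eta) * (1 - eta - s1 - s2) <=
     n%:R - n%:R * (1 + eta) * s1 - n%:R * (1 + eta) * s2.
    have : 0 <= n%:R * eta ^+ 2 by rewrite mulr_ge0// sqr_ge0.
    by rewrite expr2; nra.
  by lra.
by lra.
Qed.

(** The cost splits along the coupling. The empirical part pays 4 times the mean sample cost plus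
    the oscillation in the cells. On the missing part both origin costs are truncated at [t]: this
    pays at most $8t$ per unit of mass, and the excess is controlled by the tails [e1] and [e2]. *)
Lemma glued_cost :
  (Tcost p nu mu <= (4 * (ncost p x y / n%:R) + 16 * d%:R * delta ^+ 2 +
     4 * (2 * t * (eta + s1 + s2) + e1 + e2))%:E)%E.
Proof.
have [Z [h1 [h2 []]]] := coupling_completion pk qk w p0 q0 p1 q1 w0 w_row w_col.
set m := 1 - _ => h0 [Zrow Zcol Z0] h1p h2q [h1m h2m ZE].
have h10 k : 0 <= h1 k by have [] := h0 k k.
have h20 k : 0 <= h2 k by have [] := h0 k k.
have m0 : 0 <= m by rewrite -h1m sumr_ge0.
have mm1 : m / m <= 1 by have [->|mn] := eqVneq m 0; rewrite ?mul0r// divff.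
(* The value 1 on null cells makes both marginals of [D] exact everywhere. *)
pose D k l := if (pk k == 0) || (qk l == 0) then 1 else Z k l / (pk k * qk l).
have D0 k l : 0 <= D k l.
  by rewrite /D; case: ifP => // _; rewrite divr_ge0// mulr_ge0.
have Drow k : \sum_l D k l * qk l = 1.
  have [pz|pn] := eqVneq (pk k) 0.
    by rewrite -[RHS]q1; apply: eq_bigr => l _; rewrite /D pz eqxx mul1r.
  rewrite -[RHS](divff pn) -{1}Zrow mulr_suml; apply: eq_bigr => l _.
  rewrite /D (negPf pn)/=; have [qz|qn] := eqVneq (qk l) 0.
    rewrite qz mulr0; have : \sum_k Z k l = 0 by rewrite Zcol.
    by move/psumr_eq0P => -> //; rewrite mul0r.
  by rewrite invfM mulrA divfK.
have Dcol l : \sum_k D k l * pk k = 1.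
  have [qz|qn] := eqVneq (qk l) 0.
    by rewrite -[RHS]p1; apply: eq_bigr => k _; rewrite /D qz eqxx orbT mul1r.
  rewrite -[RHS](divff qn) -{1}Zcol mulr_suml; apply: eq_bigr => k _.
  rewrite /D (negPf qn) orbF; have [pz|pn] := eqVneq (pk k) 0.
    rewrite pz mulr0; have : \sum_l Z k l = 0 by rewrite Zrow.
    by move/psumr_eq0P => -> //; rewrite mul0r.
  by rewrite invfM mulrCA mulrC mulVKf// mulrC.
have [pi cpi piE] := balanced_coupling nu mu q mq D D0 Drow Dcol.
have mc := @measurable_cost R d p.
apply: (@le_trans _ _ (\int[pi]_z (cost p z.1 z.2)%:E)%E).
  by apply: ereal_inf_lbound; exists pi.
rewrite (piE (fun z => cost p z.1 z.2))//; last by move=> z; exact: cost_ge0.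
(* Densities of the missing masses relative to [nu] and [mu]. As they are at most 1, the tails on
   the missing part are bounded by those of [nu] and [mu]. *)
pose u1 k := h1 k / pk k; pose u2 l := h2 l / qk l.
have u1_ge0 k : 0 <= u1 k by rewrite divr_ge0.
have u2_ge0 l : 0 <= u2 l by rewrite divr_ge0.
have u1_le1 k : u1 k <= 1.
  have [pz|pn] := eqVneq (pk k) 0; first by rewrite /u1 pz invr0 mulr0.
  by rewrite ler_pdivrMr ?mul1r// lt_neqAle eq_sym pn p0.
have u2_le1 k : u2 k <= 1.
  have [qz|qn] := eqVneq (qk k) 0; first by rewrite /u2 qz invr0 mulr0.
  by rewrite ler_pdivrMr ?mul1r// lt_neqAle eq_sym qn q0.
have u1p k : u1 k * pk k = h1 k.
  have [pz|pn] := eqVneq (pk k) 0; last by rewrite divfK.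
  by apply/eqP; rewrite pz mulr0 eq_le h10/= -pz.
have u2q k : u2 k * qk k = h2 k.
  have [qz|qn] := eqVneq (qk k) 0; last by rewrite divfK.
  by apply/eqP; rewrite qz mulr0 eq_le h20/= -qz.
pose G k l := S k l * a / (pk k * qk l) + 8 * t * (u1 k * u2 l / m).
have G0 k l : 0 <= G k l.
  rewrite addr_ge0//; first by rewrite divr_ge0 ?mulr_ge0 ?S0 ?(ltW a0).
  by apply: mulr_ge0; [exact: mulr_ge0|rewrite divr_ge0// mulr_ge0].
have mo := @measurable_origin_cost R d p.
have mrt : measurable_fun setT rt.
  apply: measurable_funM => //.
  rewrite (_ : (fun z => _) = \1_[set z | t < origin_cost p z]).
    by apply: measurable_indic; exact: measurable_superlevel.
  by apply/funext => z; rewrite indicE; congr (_%:R); congr nat_of_bool; exact/esym/asboolb.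
have rt0 z : 0 <= rt z by rewrite mulr_ge0// origin_cost_ge0.
have o_rt z : origin_cost p z <= t + rt z.
  by rewrite /rt; case: ltP => h; rewrite ?mulr1 ?mulr0 ?addr0// lerDr.
have m4rt : measurable_fun setT (fun z => (4 * rt z)%:E).
  by apply/measurable_EFinP; apply: measurable_funM => //; exact: measurable_cst.
have mu1 : measurable_fun setT (fun z => (u1 (q z) / m)%:E).
  by apply/measurable_EFinP; exact: (measurable_quantized q mq (fun k => u1 k / m)).
have mu2 : measurable_fun setT (fun z => (u2 (q z) / m)%:E).
  by apply/measurable_EFinP; exact: (measurable_quantized q mq (fun k => u2 k / m)).
have ge4rt z : (0 <= (4 * rt z)%:E)%E by rewrite lee_fin mulr_ge0.
have geu1 z : (0 <= (u1 (q z) / m)%:E)%E by rewrite lee_fin divr_ge0.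
have geu2 z : (0 <= (u2 (q z) / m)%:E)%E by rewrite lee_fin divr_ge0.
(* [V1] depends on the cells only and integrates to a finite sum; [V2] and [V3] are products of
   functions of one variable and carry the two tails. *)
pose V1 (z : T * T) : \bar R := (G (q z.1) (q z.2))%:E.
pose V2 (z : T * T) : \bar R := ((4 * rt z.1)%:E * (u2 (q z.2) / m)%:E)%E.
pose V3 (z : T * T) : \bar R := ((u1 (q z.1) / m)%:E * (4 * rt z.2)%:E)%E.
have mV1 : measurable_fun setT V1.
  by apply/measurable_EFinP; exact: measurable_quantized_pair.
have mV2 : measurable_fun setT V2.
  apply: emeasurable_funM; first exact: (measurableT_comp m4rt measurable_fst).
  exact: (measurableT_comp mu2 measurable_snd).
have mV3 : measurable_fun setT V3.
  apply: emeasurable_funM; first exact: (measurableT_comp mu1 measurable_fst).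
  exact: (measurableT_comp m4rt measurable_snd).
have V1_ge0 z : (0 <= V1 z)%E by rewrite lee_fin.
have V2_ge0 z : (0 <= V2 z)%E by rewrite mule_ge0.
have V3_ge0 z : (0 <= V3 z)%E by rewrite mule_ge0.
have mV23 : measurable_fun setT (V2 \+ V3)%E by exact: emeasurable_funD.
have mD := measurable_quantized_pair q mq D.
apply: (@le_trans _ _ (\int[nu \x mu]_z (V1 z + (V2 z + V3 z)))%E).
  (* The pointwise bound is proved off the null cells, where [D] is not the default 1. *)
  apply: ae_ge0_le_integral => //.
  - by move=> z _; rewrite lee_fin mulr_ge0 ?cost_ge0.
  - by apply/measurable_EFinP; exact: measurable_funM.
  - by move=> z _; rewrite !adde_ge0.
  - exact: emeasurable_funD.
  exists [set z | (pk (q z.1) == 0) || (qk (q z.2) == 0)]; split.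
  - exact: measurable_null_cells.
  - exact: product_null_cells.
  move=> z /=; apply: contra_notP => /negP; rewrite negb_or => /andP[pn qn] _.
  set k := q z.1 in pn *; set l := q z.2 in qn *.
  rewrite /V1 /V2 /V3 -/k -/l -!EFinM -!EFinD lee_fin.
  have pkp : 0 < pk k by rewrite lt_neqAle eq_sym pn p0.
  have qlp : 0 < qk l by rewrite lt_neqAle eq_sym qn q0.
  have DE : D k l = w k l / (pk k * qk l) + u1 k * u2 l / m.
    rewrite /D (negPf pn) (negPf qn)/= ZE /u1 /u2 mulrDl; congr (_ + _).
    by rewrite invfM; ring.
  (* In good cells every sample pair counted by [N k l] is coordinatewise within [delta] of [z], so
     [cost_perturb] bounds the cost at [z] by each term of [S k l]. *)
  have cw : cost p z.1 z.2 * w k l <= S k l * a.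
    rewrite /w mulrA ler_wpM2r ?(ltW a0)//.
    have [/andP[gk gl]|] := boolP (good k && good l); last first.
      by rewrite mul0r mulr0.
    rewrite mul1r /N /joint_sum mulr_sumr; apply: ler_sum => i _.
    have [/andP[/eqP xk /eqP yl]|] := boolP (_ && _); last by rewrite !mul0r mulr0.
    rewrite !mul1r mulr1; apply: cost_perturb => //.
      by apply: close => //; rewrite xk.
    by apply: close => //; rewrite yl.
  rewrite DE mulrDr /G -addrA; apply: lerD.
    by rewrite mulrA ler_wpM2r ?invr_ge0 ?mulr_ge0.
  have mi0 : 0 <= m^-1 by rewrite invr_ge0.
  apply: (@le_trans _ _ (4 * (2 * t + rt z.1 + rt z.2) * (u1 k * u2 l / m))).
    apply: ler_wpM2r; first by rewrite mulr_ge0// mulr_ge0.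
    apply: (le_trans (cost_le_origin_cost p p12 _ _)).
    by have := o_rt z.1; have := o_rt z.2; lra.
  have h1' : rt z.1 * (u1 k * u2 l / m) <= rt z.1 * (u2 l / m).
    by rewrite ler_wpM2l// ler_wpM2r// ler_piMl.
  have h2' : rt z.2 * (u1 k * u2 l / m) <= rt z.2 * (u1 k / m).
    by rewrite ler_wpM2l// ler_wpM2r// ler_piMr.
  by lra.
rewrite ge0_integralD//; last by move=> z _; rewrite adde_ge0.
rewrite ge0_integralD//.
rewrite /V1 integral_quantized_pair//.
have uE (h : K -> R) (v : K -> R) (u : K -> R) : (forall k, u k * v k = h k) ->
    \sum_k h k = m -> \sum_k u k / m * v k = m / m.
  move=> uv hm; transitivity ((\sum_k h k) / m); last by rewrite hm.
  rewrite mulr_suml; apply: eq_bigr => k _.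
  by rewrite mulrAC uv.
have I2 : (\int[nu \x mu]_z V2 z <= (4 * e1)%:E)%E.
  have -> := integral_product_mul nu mu _ _ m4rt mu2 ge4rt geu2.
  rewrite (integral_quantized q mq mu (fun l => u2 l / m)); last first.
    by move=> l; rewrite divr_ge0.
  rewrite (uE h2)//; under eq_integral do rewrite EFinM.
  rewrite ge0_integralZl//; first last.
  - by move=> z _; rewrite lee_fin.
  - exact/measurable_EFinP.
  rewrite -[leRHS]mule1; apply: lee_pmul => //.
  - by rewrite mule_ge0// integral_ge0// => z _; rewrite lee_fin.
  - by rewrite lee_fin divr_ge0.
  - by rewrite EFinM lee_wpmul2l.
have I3 : (\int[nu \x mu]_z V3 z <= (4 * e2)%:E)%E.
  have -> := integral_product_mul nu mu _ _ mu1 m4rt geu1 ge4rt.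
  rewrite (integral_quantized q mq nu (fun l => u1 l / m)); last first.
    by move=> l; rewrite divr_ge0.
  rewrite (uE h1)//; under eq_integral do rewrite EFinM.
  rewrite ge0_integralZl//; first last.
  - by move=> z _; rewrite lee_fin.
  - exact/measurable_EFinP.
  rewrite -[leRHS]mul1e; apply: lee_pmul => //.
  - by rewrite lee_fin divr_ge0.
  - by rewrite mule_ge0// integral_ge0// => z _; rewrite lee_fin.
  - by rewrite EFinM lee_wpmul2l.
have I1 : \sum_k \sum_l G k l * (pk k * qk l) <=
    4 * (ncost p x y / n%:R) + 16 * d%:R * delta ^+ 2 + 8 * t * (eta + s1 + s2).
  apply: (@le_trans _ _ (\sum_k \sum_l (S k l * a + 8 * t * (h1 k * h2 l / m)))).
    apply: ler_sum => k _; apply: ler_sum => l _; rewrite /G mulrDl; apply: lerD.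
      have [->|pqn] := eqVneq (pk k * qk l) 0; last by rewrite divfK.
      by rewrite mulr0 mulr_ge0 ?S0 ?(ltW a0).
    by rewrite -u1p -u2q; rewrite le_eqVlt; apply/orP; left; apply/eqP; ring.
  have -> : \sum_k \sum_l (S k l * a + 8 * t * (h1 k * h2 l / m)) =
      a * (4 * ncost p x y + n%:R * (16 * d%:R * delta ^+ 2)) + 8 * t * (m * m / m).
    have -> : a * (4 * ncost p x y + n%:R * (16 * d%:R * delta ^+ 2)) = \sum_k \sum_l a * S k l.
      have := joint_sum_total (fun i => q (tnth x i)) (fun i => q (tnth y i))
        (fun i => 4 * cost p (tnth x i) (tnth y i) + 16 * d%:R * delta ^+ 2) (fun _ _ => a).
      move=> ->; rewrite -mulr_sumr big_split/= -mulr_sumr sumr_const card_ord.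
      by rewrite [n%:R * _]mulr_natl.
    have -> : 8 * t * (m * m / m) = \sum_k \sum_l 8 * t * (h1 k * h2 l / m).
      under eq_bigr do rewrite -mulr_sumr -mulr_suml -mulr_sumr h2m.
      by rewrite -mulr_sumr -mulr_suml -mulr_suml h1m.
    rewrite -big_split/=; apply: eq_bigr => k _; rewrite -big_split/=.
    by apply: eq_bigr => l _; rewrite mulrC.
  apply: lerD.
    have nc0 : 0 <= 4 * ncost p x y + n%:R * (16 * d%:R * delta ^+ 2).
      rewrite addr_ge0 ?mulr_ge0 ?sqr_ge0//.
      by do 2 (apply: sumr_ge0 => ? _); exact: alpha_ge0.
    apply: (@le_trans _ _ (n%:R^-1 * (4 * ncost p x y + n%:R * (16 * d%:R * delta ^+ 2)))).
      rewrite ler_wpM2r// /a lef_pV2 ?posrE ?nR ?na0// ler_peMr ?(ltW nR)//.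
      by rewrite lerDl ltW.
    by rewrite mulrDr mulKf ?gt_eqF ?nR// mulrCA [n%:R^-1 * _]mulrC.
  rewrite ler_wpM2l ?mulr_ge0// (le_trans _ mass_defect)// -/m.
  by rewrite -mulrA ler_piMr.
apply: (@le_trans _ _ ((4 * (ncost p x y / n%:R) + 16 * d%:R * delta ^+ 2 +
    8 * t * (eta + s1 + s2))%:E + ((4 * e1)%:E + (4 * e2)%:E))%E).
  by apply: leeD; [rewrite lee_fin|apply: leeD].
by rewrite -!EFinD lee_fin; lra.
Qed.

End GluedCost.

(** * Choice of the parameters and conclusion *)

(** The leading term is $4\cdot 8\,H/a$: 8 from the enlargement, 4 from the passage from samples to
    cells. All other terms are made smaller than an arbitrary [e]. *)
Lemma concentration_transport {R : realType} {d : nat} (mu : probability (d.-tuple R) R)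
    (p a b : R) : 1 <= p <= 2 -> 0 < a -> 0 <= b ->
  concentration mu p a b -> transport_entropy mu p (32 / a).
Proof.
move=> p12 a0 b0 conc nu.
have ca : 0 < 32 / a by rewrite divr_gt0.
have := entropy_ge0 nu mu; case entE : (entropy nu mu) => [H| |]// H0; last first.
  by rewrite gt0_muley ?leey// lte_fin.
rewrite lee_fin in H0.
apply/lee_addgt0Pr => e e0.
have oint_mu := concentration_origin_cost_integrable mu p a b p12 a0 b0 conc.
have oint_nu : nu.-integrable setT (EFin \o origin_cost p).
  by apply: (entropy_origin_cost_integrable mu p a b p12 a0 b0 conc); rewrite entE ltry.
have mo := @measurable_origin_cost R d p.
have o0 := @origin_cost_ge0 R d p.
(* Four errors of at most [e / 5] each: $8e_1$ from the tails, the oscillation in the cells,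
   $24t\eta$ from the missing mass, and $96\eta/a$ from the sample cost. *)
pose e1 := e / 40; have e10 : 0 < e1 by rewrite divr_gt0.
have [N1 _ HN1] := integrable_tail nu _ mo o0 e1 oint_nu e10.
have [N2 _ HN2] := integrable_tail mu _ mo o0 e1 oint_mu e10.
pose t : R := (maxn N1 N2)%:R.
have t0 : 0 <= t by rewrite ler0n.
pose D : R := d%:R + 1; have D1 : 1 <= D by rewrite lerDr.
have D80 : 0 < 80 * D by rewrite mulr_gt0// (lt_le_trans ltr01).
have t120 : 0 < 120 * (t + 1) by rewrite mulr_gt0// ltr_wpDl.
have a480 : 0 < 480 / a by apply: divr_gt0 a0; rewrite ltr0n.
pose delta := Num.min 1 (e / (80 * D)).
have delta0 : 0 < delta by rewrite lt_min ltr01 divr_gt0.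
have delta_e : 16 * d%:R * delta ^+ 2 <= e / 5.
  have d1 : delta ^+ 2 <= delta by rewrite expr2 ler_piMl ?(ltW delta0)// ge_min lexx.
  have d2 : delta * (80 * D) <= e by rewrite -ler_pdivlMr// ge_min lexx orbT.
  have d3 : d%:R * delta ^+ 2 <= D * delta.
    by apply: ler_pM => //; rewrite ?sqr_ge0// lerDl.
  by clear -d2 d3; lra.
pose eta := Num.min (e / (480 / a)) (e / (120 * (t + 1))).
have eta0 : 0 < eta by rewrite lt_min (divr_gt0 e0 a480) (divr_gt0 e0 t120).
have eta1 : eta * (480 / a) <= e by rewrite -ler_pdivlMr// ge_min lexx.
have eta2 : eta * (120 * (t + 1)) <= e.
  by rewrite -ler_pdivlMr// ge_min lexx orbT.
have [K [q [good [mq close bad1 bad2]]]] := quantization nu mu delta eta delta0 eta0.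
have [n [x [y [n0 nxy c1 c2]]]] :=
  matched_samples nu mu q mq p a b p12 a0 conc H eta entE eta0.
have tl1 := HN1 (maxn N1 N2) (leq_maxl _ _); have tl2 := HN2 (maxn N1 N2) (leq_maxr _ _).
apply: (le_trans (glued_cost nu mu p p12 q good mq delta eta t e1 e1 eta eta
  (ltW delta0) eta0 t0 close bad1 bad2 tl1 tl2 x y n0 c1 c2)).
rewrite -EFinM -EFinD lee_fin.
have nR : 0 < n%:R :> R by rewrite ltr0n.
have cxy : ncost p x y / n%:R <= 8 * (H / a) + (eta * (480 / a)) / 20.
  have -> : 8 * (H / a) + (eta * (480 / a)) / 20 = 8 * (H + 3 * eta) / a.
    by field; rewrite gt_eqF.
  by rewrite ler_pdivrMr// mulrC.
have -> : 32 / a * H = 32 * (H / a) by rewrite mulrAC mulrA.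
have teta : t * eta <= e / 120 by clear -eta0 eta2; lra.
move: (H / a) (ncost p x y / n%:R) (16 * d%:R * delta ^+ 2) (eta * (480 / a))
  cxy delta_e eta1 => h c u v cxy delta_e eta1.
by rewrite /e1; clear -e0 cxy delta_e eta1 teta; lra.
Qed.

Theorem theorem4p2 (R : realType) (d : nat) (mu : probability (d.-tuple R) R) (p : R) :
  1 <= p <= 2 ->
  [/\ (forall a b : R, 0 < a -> 0 <= b ->
         concentration mu p a b -> transport_entropy mu p (288 / a)),
      (forall C : R, 0 < C ->
         transport_entropy mu p C -> concentration mu p (1 / (2 * C)) 2) &
      ((exists a b : R, [/\ 0 < a, 0 <= b & concentration mu p a b]) <->
       (exists C : R, 0 < C /\ transport_entropy mu p C))].
Proof.
move=> p12; split.
- move=> a b a0 b0 conc nu.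
  apply: le_trans (concentration_transport _ _ _ _ p12 a0 b0 conc nu) _.
  (* Since entropy is nonnegative, the constant 32 may be raised to 288. *)
  rewrite lee_wpmul2r ?entropy_ge0// lee_fin ler_wpM2r ?invr_ge0 ?(ltW a0)//.
  by rewrite ler_nat.
- by move=> C C0 TH; exact: transport_concentration.
- split=> [[a [b [a0 b0 conc]]]|[C [C0 TH]]].
    exists (32 / a); split; first by rewrite divr_gt0.
    exact: concentration_transport conc.
  exists (1 / (2 * C)), 2; split => //; first by rewrite divr_gt0// mulr_gt0.
  exact: transport_concentration.
Qed.
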